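(* Let $E$ be a real Banach space, $H$ a real separable Hilbert space, $S=(S(t))_{t\ge 0}$ a $C_0$-semigroup on $E$, $B\in\mathscr{L}(H,E)$ a bounded linear operator and $W_H$ an $H$-cylindrical Brownian motion. Assume that $s\mapsto S(s)B$ is stochastically integrable with respect to $W_H$ on every interval $[0,T]$. Fix $t>0$. Suppose that $\xi\in E$ and $h\in L^2(0,t;H)$ satisfy $$S(t)\xi=R_th,\qquad\text{where } R_tv:=\int_0^tS(t-s)Bv(s)\,\mathrm{d}s,\quad v\in L^2(0,t;H).$$ Then, for every bounded Borel function $f:E\to\mathbb{R}$ and every $x\in E$, the derivative $D_\xi P_tf(x):=\frac{\mathrm{d}}{\mathrm{d}\varepsilon}\big|_{\varepsilon=0}P_tf(x+\varepsilon\xi)$ exists and $$D_\xi P_tf(x)=\mathbb{E}\bigl[f(U_t^x)W_t(h)\bigr]=\mathbb{E}\Bigl[f(U_t^x)\int_0^t\bigl(\Pi_th(s)\big|\mathrm{d}W_H(s)\bigr)_H\Bigr],$$ where $W_t$ is the $L^2(0,t;H)$-isonormal Gaussian process associated with $W_H$ and $\Pi_t$ is the orthogonal projection of $L^2(0,t;H)$ onto $(\operatorname{Ker}R_t)^\perp$.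
   Context: An $H$-cylindrical Brownian motion is a family $W_H(t):H\to L^2(\Omega)$, $t\ge 0$, of bounded linear operators such that all vectors $(W_H(t_1)h_1,\dots,W_H(t_N)h_N)$ are centred Gaussian and $\mathbb{E}(W_H(s)g\,W_H(t)h)=(s\wedge t)(g|h)_H$. For a real separable Hilbert space $\mathscr{H}$, an $\mathscr{H}$-isonormal Gaussian process is a bounded linear operator $W:\mathscr{H}\to L^2(\Omega)$ such that all vectors $(Wh_1,\dots,Wh_N)$ are centred Gaussian and $\mathbb{E}(Wg\,Wh)=(g|h)_{\mathscr{H}}$. The formula $W(\mathbf{1}_{(a,b]}\otimes h)=W_H(b)h-W_H(a)h$ extends uniquely to an $L^2(\mathbb{R}_+;H)$-isonormal process $W$; its restriction to $L^2(0,t;H)$ (functions extended by zero) is denoted $W_t$, and one writes $\int_0^t(f(s)|\mathrm{d}W_H(s))_H:=W_t(f)$ for $f\in L^2(0,t;H)$. A bounded operator $R:\mathscr{H}\to E$ is $\gamma$-radonifying, $R\in\gamma(\mathscr{H},E)$, if for one (equivalently every) orthonormal basis $(h_n)$ of $\mathscr{H}$ and independent standard Gaussians $(\gamma_n)$ the series $\sum_n\gamma_nRh_n$ converges in $L^2(\Omega;E)$. Given such $R$ and an $\mathscr{H}$-isonormal process $W$, $X_R$ denotes the (a.s. unique) centred $E$-valued Gaussian random variable with $\langle X_R,x^*\rangle=W(R^*x^* )$ for all $x^*\in E^*$. A function $\Phi:\mathbb{R}_+\to\mathscr{L}(H,E)$ is stochastically integrable with respect to $W_H$ if $s\mapsto\langle\Phi(s)h,x^*\rangle$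 is square integrable for all $h\in H$, $x^*\in E^*$, and there is $I_\Phi\in\gamma(L^2(\mathbb{R}_+;H),E)$ with $\langle I_\Phi(\mathbf{1}_{[a,b)}\otimes h),x^*\rangle=\int_a^b\langle\Phi(s)h,x^*\rangle\,\mathrm{d}s$ for all $0\le a<b<\infty$, $h\in H$, $x^*\in E^*$; then $\int_0^\infty\Phi\,\mathrm{d}W_H:=X_{I_\Phi}$. Integrability on a finite interval is defined by extending by zero. Stochastic integrability of $s\mapsto S(s)B$ on $[0,t]$ implies that of $s\mapsto S(t-s)B$ on $[0,t]$; the associated $\gamma$-radonifying operator is $R_t$. The stochastic convolution is $W_A(t):=\int_0^tS(t-s)B\,\mathrm{d}W_H(s)=X_{R_t}$ (formed with $W_t$). For $x\in E$ put $U_t^x:=S(t)x+W_A(t)$, and for bounded Borel $f:E\to\mathbb{R}$ put $P_tf(x):=\mathbb{E}f(U_t^x)$. *)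

(* Defs.v *)
From HB Require Import structures.
From mathcomp Require Import all_boot all_order all_algebra.
From mathcomp Require Import sesquilinear.
From mathcomp Require Import all_classical all_reals all_analysis.

Set Implicit Arguments.
Unset Strict Implicit.
Unset Printing Implicit Defensive.

Import Order.TTheory GRing.Theory Num.Theory.
Import numFieldTopology.Exports numFieldNormedType.Exports.

Local Open Scope classical_set_scope.
Local Open Scope ring_scope.

(* An inner product [ip] turns the Banach space H into a Hilbert space when
   the norm of H is the one given by [ip]. *)
Definition induces_norm (R : realType) (H : normedModType R)
    (ip : {dot H for idfun}) : Prop :=
  forall x : H, ip x x = `|x| ^+ 2.

Definition separable (H : topologicalType) : Prop :=
  exists2 C : set H, countable C & dense C.

(* Strong measurability is required pointwise on [D], not almost everywhere:
   every class of functions has such a representative, and norms and Borel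
   images of it are then measurable without completing the measure. *)
Section bochner.
Context d (T : measurableType d) (R : realType) (V : normedModType R).
Implicit Types (mu : set T -> \bar R) (D : set T) (s f : T -> V).

Definition simple_fun s : Prop :=
  finite_set (range s) /\ forall y, measurable (s @^-1` [set y]).

Definition strongly_measurable D f : Prop :=
  exists2 s : nat -> T -> V, (forall n, simple_fun (s n)) &
    forall x, D x -> s n x @[n --> \oo] --> f x.

Definition simple_integrable mu D s : Prop :=
  simple_fun s /\
  forall y, y != 0 -> (mu (D `&` s @^-1` [set y]) < +oo)%E.

Definition simple_integral mu D s : V :=
  \sum_(y \in range s) fine (mu (D `&` s @^-1` [set y])) *: y.

Definition is_bochner_integral mu D f (y : V) : Prop :=
  strongly_measurable D f /\
  exists s : nat -> T -> V,
    [/\ forall n, simple_integrable mu D (s n),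
        (\int[mu]_(x in D) (`|f x - s n x|)%:E)%E @[n --> \oo] --> 0%E &
        simple_integral mu D (s n) @[n --> \oo] --> y].

Definition bochner_integral mu D f : V := xget 0 (is_bochner_integral mu D f).

End bochner.

(* A Hilbert space of equivalence classes, such as L^2(0,t;H), is represented
   by a subspace [L] of an ambient space of functions together with a positive
   semidefinite form [b] on [L]; two elements of [L] are identified when their
   difference is [b]-null.  The operators below are bounded for the seminorm
   of [b], hence do not depend on representatives. *)

Section hilbert_representatives.
Context (R : realType) (V : lmodType R) (L : set V) (b : V -> V -> R).

Definition bounded_operator (E : normedModType R) (A : V -> E) : Prop :=
  (forall (a : R) u v, L u -> L v -> A (a *: u + v) = a *: A u + A v) /\
  exists C : R, forall u, L u -> `|A u| <= C * Num.sqrt (b u u).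

Definition op_kernel (E : normedModType R) (A : V -> E) : set V :=
  [set v | L v /\ A v = 0].

Definition orth_complement (K : set V) : set V :=
  [set v | L v /\ forall k, K k -> b v k = 0].

Definition is_orth_projection (K : set V) (p : V -> V) : Prop :=
  forall v, L v -> K (p v) /\ forall k, K k -> b (v - p v) k = 0.

(* A countable orthonormal basis, indexed by a set [J] of natural numbers, so
   that finite-dimensional (and zero) spaces are covered. *)
Definition orthonormal_basis (J : set nat) (e : nat -> V) : Prop :=
  [/\ forall n, J n -> L (e n),
      forall m n, J m -> J n -> b (e m) (e n) = (m == n)%:R &
      forall v, L v ->
        let r N := v - \sum_(n < N | (n : nat) \in J) b v (e n) *: e n in
        b (r N) (r N) @[N --> \oo] --> (0 : R)].

(* [g] is the vector [A^* x'], determined up to [b]-null vectors. *)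
Definition is_adjoint_at (E : normedModType R) (A : V -> E) (x' : E -> R)
    (g : V) : Prop :=
  L g /\ forall v, L v -> b g v = x' (A v).

End hilbert_representatives.

Section gaussian.
Context d (T : measurableType d) (R : realType) (P : probability T R).

(* The degenerate law is listed separately because [normal_prob 0 0] is not
   the Dirac mass. *)
Definition centred_gaussian (X : T -> R) : Prop :=
  measurable_fun [set: T] X /\
  exists sigma : R, forall A : set R, measurable A ->
    pushforward P X A =
      if sigma == 0 then dirac (0 : R) A else normal_prob 0 sigma A.

Definition standard_gaussian (X : T -> R) : Prop :=
  measurable_fun [set: T] X /\
  forall A : set R, measurable A -> pushforward P X A = normal_prob 0 1 A.

Definition centred_gaussian_vector (N : nat) (X : 'I_N -> T -> R) : Prop :=
  forall c : 'I_N -> R, centred_gaussian (fun w => \sum_(i < N) c i * X i w).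

Definition mutually_independent (J : set nat) (X : nat -> T -> R) : Prop :=
  forall (F : seq nat) (A : nat -> set R), uniq F -> [set` F] `<=` J ->
    (forall n, measurable (A n)) ->
    P (\bigcap_(n in [set` F]) (X n @^-1` A n)) =
      (\prod_(n <- F) P (X n @^-1` A n))%E.

Definition L2_bounded_operator (V : lmodType R) (L : set V) (b : V -> V -> R)
    (W : V -> T -> R) : Prop :=
  [/\ forall g, L g -> W g \in Lfun P 2%:E,
      forall (a : R) g h, L g -> L h ->
        {ae P, forall w, W (a *: g + h) w = a * W g w + W h w} &
      exists C : R, forall g, L g ->
        ('E_P[(fun w => W g w ^+ 2)%R] <= (C * b g g)%:E)%E].

Definition isonormal_process (V : lmodType R) (L : set V) (b : V -> V -> R)
    (W : V -> T -> R) : Prop :=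
  [/\ L2_bounded_operator L b W,
      forall N (h : 'I_N -> V), (forall i, L (h i)) ->
        centred_gaussian_vector (fun i => W (h i)) &
      forall g h, L g -> L h ->
        'E_P[(fun w => W g w * W h w)%R]%E = (b g h)%:E].

Definition cylindrical_brownian_motion (H : normedModType R)
    (ip : {dot H for idfun}) (WH : R -> H -> T -> R) : Prop :=
  [/\ forall t, 0 <= t -> L2_bounded_operator [set: H] ip (WH t),
      forall N (t : 'I_N -> R) (h : 'I_N -> H), (forall i, 0 <= t i) ->
        centred_gaussian_vector (fun i => WH (t i) (h i)) &
      forall s t g h, 0 <= s -> 0 <= t ->
        'E_P[(fun w => WH s g w * WH t h w)%R]%E = (Num.min s t * ip g h)%:E].

(* [X] is the E-valued centred Gaussian random variable [X_A] with
   [<X_A, x'> = W (A^* x')], which is unique up to null sets. *)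
Definition is_gaussian_rv (V : lmodType R) (L : set V) (b : V -> V -> R)
    (W : V -> T -> R) (E : normedModType R) (A : V -> E) (X : T -> E) : Prop :=
  [/\ strongly_measurable [set: T] X,
      forall x' : {linear E -> R^o}, continuous x' ->
        centred_gaussian (fun w => x' (X w)) &
      forall x' : {linear E -> R^o}, continuous x' ->
        exists2 g, is_adjoint_at L b A x' g &
          {ae P, forall w, x' (X w) = W g w}].

End gaussian.

(* One basis and one Gaussian sequence suffice; the latter lives on an
   auxiliary probability space.  [Y] is the sum of the series in L^2(T;E). *)
Definition gamma_radonifying (R : realType) (V : lmodType R) (L : set V)
    (b : V -> V -> R) (E : normedModType R) (A : V -> E) : Prop :=
  bounded_operator L b A /\
  exists (J : set nat) (e : nat -> V), orthonormal_basis L b J e /\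
  exists d (T : measurableType d) (P : probability T R) (g : nat -> T -> R)
      (Y : T -> E),
    [/\ forall n, J n -> standard_gaussian P (g n),
        mutually_independent P J g,
        strongly_measurable [set: T] Y,
        ('E_P[(fun w => `|Y w| ^+ 2)%R] < +oo)%E &
        'E_P[(fun w => `|\sum_(n < N | (n : nat) \in J) g n w *: A (e n)
                          - Y w| ^+ 2)%R]%E @[N --> \oo] --> 0%E].

Section stochastic_integral.
Context (R : realType) (H : normedModType R) (ip : {dot H for idfun}).
Local Notation lambda := (@lebesgue_measure R).

Definition L2fun (I : set R) : set (R -> H) :=
  [set u | strongly_measurable I u /\
           (\int[lambda]_(s in I) (`|u s| ^+ 2)%:E < +oo)%E].

Definition L2ip (I : set R) (u v : R -> H) : R :=
  \int[lambda]_(s in I) ip (u s) (v s).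

Definition square_integrable (I : set R) (u : R -> R) : Prop :=
  measurable_fun I u /\ (\int[lambda]_(s in I) (u s ^+ 2)%:E < +oo)%E.

Definition indic_tensor (A : set R) (h : H) : R -> H := fun s => \1_A s *: h.

Definition extend0 (I : set R) (u : R -> H) : R -> H := fun s => \1_I s *: u s.

Definition is_isonormal_extension d (T : measurableType d)
    (P : probability T R) (WH : R -> H -> T -> R) (W : (R -> H) -> T -> R)
    : Prop :=
  isonormal_process P (L2fun `[0, +oo[) (L2ip `[0, +oo[) W /\
  forall (a b : R) (h : H), 0 <= a -> a < b ->
    {ae P, forall w,
      W (indic_tensor `]a, b] h) w = WH b h w - WH a h w}.

(* [W_t]; its value [W_t g] is also the stochastic integral of [g] against
   [WH] over (0,t). *)
Definition isonormal_restr (T : Type) (W : (R -> H) -> T -> R) (t : R)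
    (g : R -> H) : T -> R := W (extend0 `]0, t[ g).

Context (E : normedModType R).

Definition stochastically_integrable (Phi : R -> {linear H -> E}) : Prop :=
  [/\ forall s, 0 <= s -> continuous (Phi s),
      forall (h : H) (x' : {linear E -> R^o}), continuous x' ->
        square_integrable `[0, +oo[ (fun s => x' (Phi s h)) &
      exists2 I : (R -> H) -> E,
        gamma_radonifying (L2fun `[0, +oo[) (L2ip `[0, +oo[) I &
        forall (a b : R) (h : H) (x' : {linear E -> R^o}),
          0 <= a -> a < b -> continuous x' ->
          x' (I (indic_tensor `[a, b[ h)) =
            \int[lambda]_(s in `[a, b]) (x' (Phi s h) : R)].

Definition stochastically_integrable_on (T : R) (Phi : R -> {linear H -> E})
    : Prop :=
  stochastically_integrable
    (fun s => if s \in `[0, T] then Phi s else (\0 : {linear H -> E})).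

Definition C0_semigroup (S : R -> {linear E -> E}) : Prop :=
  [/\ forall t, 0 <= t -> continuous (S t),
      forall x, S 0 x = x,
      forall s t x, 0 <= s -> 0 <= t -> S (s + t) x = S s (S t x) &
      forall x, S t x @[t --> 0^'+] --> x].

Definition R_op (S : R -> {linear E -> E}) (B : {linear H -> E}) (t : R)
    (v : R -> H) : E :=
  bochner_integral lambda `]0, t[ (fun s => S (t - s) (B (v s))).

End stochastic_integral.

Section transition_operator.
Context (R : realType) (E : normedModType R).

Definition bounded_borel (f : E -> R) : Prop :=
  measurable_fun [set: g_sigma_algebraType (@open E)] f /\
  exists M : R, forall x, `|f x| <= M.

(* [U_t^x], with [X] standing for the stochastic convolution at time [t] *)
Definition mild_solution (T : Type) (S : R -> {linear E -> E}) (X : T -> E)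
    (t : R) (x : E) : T -> E := fun w => S t x + X w.

Definition transition_op d (T : measurableType d) (P : probability T R)
    (S : R -> {linear E -> E}) (X : T -> E) (t : R) (f : E -> R) : E -> R^o :=
  fun x => fine 'E_P[fun w => f (mild_solution S X t x w)]%E.

End transition_operator.

(* Main.v *)
(** The Cameron-Martin theorem turns the translation of [W_A(t)] by
    [e S(t) xi = e R_t h] into a change of density: with [Y = W_t(h)],
    [P_t f(x + e xi) = E (f(U) exp(e Y - e^2 E(Y^2) / 2))], and the derivative
    at [e = 0] is [E (f(U) Y)].
    The identity is first checked on the functions [cos(l + a)] with [l] in the
    dual of [E], where it only involves the Gaussian pair [(l(W_A(t)), Y)].
    These functions span an algebra; indicators of finite intersections of
    half-spaces are bounded pointwise limits of its elements, and by
    Hahn-Banach such intersections generate the Borel sets of a separable part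
    of [E] that carries [W_A(t)].
    Finally [h - Pi_t h] is orthogonal to every [R_t^* l], so the same formula
    for the translation by the zero vector gives [E (f(U) W_t(h - Pi_t h)) = 0]. *)

Require Import Defs.
From HB Require Import structures.
From mathcomp Require Import all_boot all_order all_algebra.
From mathcomp Require Import sesquilinear.
From mathcomp Require Import all_classical all_reals all_analysis.
From mathcomp Require Import measurable_realfun lebesgue_integral_under.
From mathcomp Require Import ring lra.

Set Implicit Arguments.
Unset Strict Implicit.
Unset Printing Implicit Defensive.

Import Order.TTheory GRing.Theory Num.Theory.
Import numFieldTopology.Exports numFieldNormedType.Exports.

Local Open Scope classical_set_scope.
Local Open Scope ring_scope.

(** * Norming functionals *)

(** Two obstacles shape the proof. [E] may be non-separable, and then half-spaces need not generate
    its Borel sets; strong measurability supplies a countable family whose closure contains all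
    values of [W_A(t)] and of its translate, and Borel sets are compared with cylinder sets on that
    closure only. The pair [(X, Y)] with [X = l(W_A(t))] may be degenerate, and all that is known of
    it is that its real linear combinations are centred Gaussian, so a joint density is avoided. The
    mixed quantity [E (cos(X + a) exp(e Y))] does not involve a single real combination:
    [cos(X + a)] is first replaced by its conditional expectation given [Y], again a multiple of a
    cosine. Because the uniqueness argument allows weights of any sign, this replacement is an
    instance of it on the real line. A phase in every cosine takes the place of complex
    exponentials. *)

Lemma norming_functional (R : realType) (E : normedModType R) (x : E) :
  exists l : {linear E -> R^o},
    [/\ continuous l, forall y, `|l y| <= `|y| & l x = `|x|].
Proof.
(* Graphs of partial linear functionals; being dominated by the norm makes them
   single-valued. *)
pose P (A : set (E * R)) :=
  [/\ forall a p q, A p -> A q -> A (a *: p.1 + q.1, a * p.2 + q.2),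
      forall p, A p -> p.2 <= `|p.1| &
      A = set0 \/ A (x, `|x|)].
have [F FP Ftot|A [[Alin Adom Ax] Amax]] := @Zorn_bigcup _ P.
  split.
  - move=> a p q [X FX Xp] [Y FY Yq].
    have [XY|YX] := Ftot _ _ FX FY.
      by exists Y => //; have [+ _ _] := FP _ FY; apply => //; exact: XY.
    by exists X => //; have [+ _ _] := FP _ FX; apply => //; exact: YX.
  - by move=> p [X FX Xp]; have [_ + _] := FP _ FX; exact.
  - have [[X FX X0]|F0] := pselect (exists2 X, F X & X !=set0).
      right; exists X => //; have [_ _ []//] := FP _ FX.
      by move=> X00; move: X0; rewrite X00 => -[].
    left; apply/seteqP; split => // p [X FX Xp].
    by case: F0; exists X => //; exists p.
have {}Ax : A (x, `|x|).
  case: Ax => // A0; exfalso.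
  apply: (Amax [set p | exists c : R, p = (c *: x, c * `|x|)]).
    rewrite A0; split=> // /(_ (0 *: x, 0 * `|x|)) /=; apply.
    by exists 0.
  split.
  - move=> a _ _ [c ->] [c' ->] /=; exists (a * c + c').
    by rewrite scalerDl scalerA mulrDl mulrA.
  - by move=> _ [c ->] /=; rewrite normrZ ler_wpM2r// ler_norm.
  - by right; exists 1; rewrite scale1r mul1r.
have A00 : A (0, 0).
  have := Alin (-1) _ _ Ax Ax.
  by rewrite /= scaleN1r addNr mulN1r addNr.
have Auniq v r r' : A (v, r) -> A (v, r') -> r = r'.
  suff H s s' : A (v, s) -> A (v, s') -> s <= s'.
    by move=> Ar Ar'; apply/eqP; rewrite eq_le !H.
  move=> As As'; have := Adom _ (Alin (-1) _ _ As' As).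
  by rewrite /= scaleN1r addNr normr0 mulN1r addrC subr_le0.
have Atot v : exists r, A (v, r).
  apply: contrapT => nAv.
  (* A value at [v] compatible with the norm bound must lie above every element of [L] and below
     every [|q.1 + v| - q.2]. [Lub] shows that such a value exists, and [sup L] is one. *)
  pose L := [set p.2 - `|p.1 - v| | p in A].
  have Lub p q : A p -> A q -> p.2 - `|p.1 - v| <= `|q.1 + v| - q.2.
    move=> Ap Aq; rewrite lerBlDr addrAC lerBrDr.
    have := Adom _ (Alin 1 _ _ Ap Aq); rewrite /= mul1r scale1r => /le_trans; apply.
    rewrite -[X in `|X| <= _](_ : (q.1 + v) + (p.1 - v) = _) ?ler_normD//.
    by rewrite addrACA subrr addr0 addrC.
  have L0 : L !=set0 by exists (0 - `|0 - v|), (0, 0).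
  have supL : has_sup L.
    split => //; exists (`|0 + v| - 0) => _ [p Ap <-].
    exact: (Lub p (0, 0)).
  pose c := sup L.
  have cL p : A p -> p.2 - `|p.1 - v| <= c.
    by move=> Ap; apply: ub_le_sup; [exact: supL.2|exists p].
  have cU q : A q -> c <= `|q.1 + v| - q.2.
    by move=> Aq; apply: ge_sup => // _ [p Ap <-]; exact: Lub.
  apply: (Amax [set p | exists2 q, A q & exists t, p = (q.1 + t *: v, q.2 + t * c)]).
    split.
      move=> [u r] Aur; exists (u, r) => //; exists 0 => /=.
      by rewrite scale0r mul0r !addr0.
    move=> sA; apply: nAv; exists c; apply: sA; exists (0, 0) => //.
    by exists 1 => /=; rewrite scale1r mul1r !add0r.
  split.
  - move=> a _ _ [q Aq [t ->]] [q' Aq' [t' ->]] /=.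
    exists (a *: q.1 + q'.1, a * q.2 + q'.2); first exact: Alin.
    exists (a * t + t') => /=.
    by congr pair; [rewrite scalerDr scalerA scalerDl addrACA|ring].
  - move=> _ [q Aq [t ->]] /=.
    have [t0|t0|->] := ltgtP t 0; last first.
    + by rewrite scale0r mul0r !addr0; exact: Adom.
    + have Aq' : A (t^-1 *: q.1, t^-1 * q.2).
        by have := Alin t^-1 _ _ Aq A00; rewrite /= !addr0.
      have /= := cU _ Aq'.
      rewrite lerBrDr -(ler_pM2l t0) mulrDr mulVKf ?gt_eqF// addrC.
      move=> /le_trans; apply.
      by rewrite -{1}(gtr0_norm t0) -normrZ scalerDr scalerA mulfV ?gt_eqF// scale1r.
    + have Nt0 : 0 < - t by rewrite oppr_gt0.
      have Aq' : A ((- t)^-1 *: q.1, (- t)^-1 * q.2).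
        by have := Alin (- t)^-1 _ _ Aq A00; rewrite /= !addr0.
      have /= := cL _ Aq'.
      rewrite lerBlDr -(ler_pM2l Nt0) mulrDr mulVKf ?gt_eqF// mulNr addrC.
      rewrite -lerBlDr opprK => /le_trans; apply.
      rewrite -{1}(gtr0_norm Nt0) -normrZ scalerBr scalerA mulfV ?gt_eqF// scale1r.
      by rewrite scaleNr opprK.
  - by right; exists (x, `|x|) => //; exists 0 => /=; rewrite scale0r mul0r !addr0.
have [l Al] := choice Atot.
have llin : linear (l : E -> R^o).
  move=> a u v; apply: (Auniq (a *: u + v)); first exact: Al.
  exact: (Alin _ _ _ (Al u) (Al v)).
pose lE : {linear E -> R^o} :=
  HB.pack_for {linear E -> R^o} (l : E -> R^o) (GRing.isLinear.Build _ _ _ _ _ llin).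
have lle y : `|lE y| <= `|y|.
  rewrite ler_norml (Adom _ (Al y)) andbT lerNl -(linearN lE) -(normrN y).
  exact: (Adom _ (Al (- y))).
exists lE; split => //; last exact: (Auniq x).
apply: bounded_linear_continuous; apply/linear_boundedP.
exists 1; split; first exact: real1.
move=> r r1 y; apply: (le_trans (lle y)).
by rewrite ler_peMl// ltW.
Qed.

(** * Trigonometric polynomials determine weighted laws *)

Lemma measurable_cos (R : realType) : measurable_fun [set: R] (@cos R).
Proof. by apply: continuous_measurable_fun; exact: continuous_cos. Qed.

Lemma measurable_sin (R : realType) : measurable_fun [set: R] (@sin R).
Proof. by apply: continuous_measurable_fun; exact: continuous_sin. Qed.

Lemma norm_cos_le1 (R : realType) (x : R) : `|cos x| <= 1.
Proof. by rewrite ler_norml cos_geN1 cos_le1. Qed.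

Lemma norm_sin_le1 (R : realType) (x : R) : `|sin x| <= 1.
Proof. by rewrite ler_norml sin_geN1 sin_le1. Qed.

Section real_expectation.
Context d (Om : measurableType d) (R : realType) (P : probability Om R).
Implicit Types (f g : Om -> R).
Local Notation intble f := (P.-integrable setT (EFin \o f)).

Lemma integrable_measurable f : intble f -> measurable_fun setT f.
Proof. by move=> /(measurable_int P)/measurable_EFinP. Qed.

Lemma integrable_dominated f g : measurable_fun setT f -> intble g ->
  (forall w, `|f w| <= g w) -> intble f.
Proof.
move=> mf ig fg; apply: (le_integrable _ _ _ ig) => //.
  exact/measurable_EFinP.
move=> w _ /=; rewrite lee_fin.
by rewrite (le_trans (fg w))// ler_norm.
Qed.

Lemma integrable_boundedM (M : R) f (w : Om -> R) : measurable_fun setT f ->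
  (forall x, `|f x| <= M) -> intble w -> intble (fun x => f x * w x).
Proof.
move=> mf fM iw; have mw := integrable_measurable iw.
apply: (@integrable_dominated _ (fun x => M * `|w x|)).
- exact: measurable_funM.
- exact: (integrableZl measurableT M (integrable_norm iw)).
- by move=> x; rewrite normrM ler_wpM2r.
Qed.

Lemma integrable_bounded (M : R) f : measurable_fun setT f ->
  (forall x, `|f x| <= M) -> intble f.
Proof.
move=> mf fM; apply: (@integrable_dominated _ (cst M)) => //.
exact: finite_measure_integrable_cst.
Qed.

Lemma dominated_Rintegral (f_ : nat -> Om -> R) f g :
  (forall n, measurable_fun setT (f_ n)) ->
  (forall w, f_ n w @[n --> \oo] --> f w) ->
  intble g -> (forall n w, `|f_ n w| <= g w) ->
  intble f /\ \int[P]_w f_ n w @[n --> \oo] --> \int[P]_w f w.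
Proof.
move=> mf_ f_f ig f_g.
have mf : measurable_fun setT f.
  by apply: (measurable_fun_cvg (h := f_)) => // w _; exact: f_f.
have [] := @dominated_convergence _ _ _ P _ measurableT
  (fun n x => (f_ n x)%:E) (EFin \o f) (EFin \o g).
- by move=> n; exact/measurable_EFinP.
- exact/measurable_EFinP.
- apply: aeW => x _; apply: cvg_EFin; first exact: nearW.
  exact: f_f.
- exact: ig.
- by apply: aeW => x n _; rewrite /= lee_fin f_g.
move=> intf _ cvgf.
split => //; apply: fine_cvg; rewrite fineK//.
exact: integrable_fin_num.
Qed.

End real_expectation.

(** * Polynomial approximation of the sign *)

Section sign_approximation.
Context (R : realType).
Implicit Types s y : R.

(* Newton-Schulz iteration: on [-1, 1] the iterates of this polynomial converge
   to the sign, and they keep trigonometric polynomials trigonometric. *)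
Definition sign_step s := s * (3 - s ^+ 2) / 2.

(** From [1 - sign_step s = (1 - s) ^+ 2 * (2 + s) / 2]: one step multiplies the distance to 1 by
    [(1 - s) * (2 + s) / 2], which is at most [1 - s / 2]. *)
Lemma sign_step_itv s : 0 <= s <= 1 ->
  s <= sign_step s <= 1 /\ 1 - sign_step s <= (1 - s / 2) * (1 - s).
Proof.
move=> /andP[s0 s1]; have t0 : 0 <= 1 - s by rewrite subr_ge0.
have s3 : 0 <= 2 + s by rewrite addr_ge0.
have h1 : sign_step s = s + s * (1 - s) * (1 + s) / 2 by rewrite /sign_step; field.
have h2 : 1 - sign_step s = (1 - s) ^+ 2 * (2 + s) / 2 by rewrite /sign_step; field.
have h3 : (1 - s / 2) * (1 - s) = 1 - sign_step s + (1 - s) * s ^+ 2 / 2.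
  by rewrite /sign_step; field.
split; last by rewrite h3 lerDl divr_ge0// mulr_ge0// sqr_ge0.
rewrite {1}h1 lerDl !(mulr_ge0, divr_ge0)// ?addr_ge0//=.
by rewrite -subr_ge0 h2 divr_ge0// mulr_ge0// sqr_ge0.
Qed.

Lemma sign_stepN s : sign_step (- s) = - sign_step s.
Proof. by rewrite /sign_step sqrrN !mulNr. Qed.

Lemma iter_sign_stepN n s : iter n sign_step (- s) = - iter n sign_step s.
Proof. by elim: n => //= n ->; rewrite sign_stepN. Qed.

(** The iterates increase, so every later contraction factor is bounded by the initial one,
    [1 - s / 2]. *)
Lemma iter_sign_step_itv n s : 0 <= s <= 1 ->
  s <= iter n sign_step s <= 1 /\ 1 - iter n sign_step s <= (1 - s / 2) ^+ n.
Proof.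
move=> /andP[s0 s1]; elim: n => [|n [/andP[sn n1 IH]]] /=.
  by rewrite expr0; split; [rewrite lexx s1|rewrite gerBl].
have [|/andP[h1 h2 h3]] := @sign_step_itv (iter n sign_step s).
  by rewrite (le_trans s0 sn) n1.
split; first by rewrite (le_trans sn h1) h2.
apply: (le_trans h3); rewrite exprS.
apply: ler_pM => //; rewrite ?subr_ge0//; first by nra.
by rewrite lerB// ler_pM2r ?invr_gt0.
Qed.

Lemma iter_sign_step_norm n s : `|s| <= 1 -> `|iter n sign_step s| <= 1.
Proof.
have H u : 0 <= u -> `|u| <= 1 -> `|iter n sign_step u| <= 1.
  move=> u0; rewrite ger0_norm// => u1.
  have [|/andP[h1 h2] _] := @iter_sign_step_itv n u; first exact/andP.
  by rewrite ger0_norm// (le_trans u0).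
have [s0|s0] := leP 0 s; first exact: H.
by rewrite -(normrN s) -(normrN (iter _ _ _)) -iter_sign_stepN => /H; apply; rewrite oppr_ge0 ltW.
Qed.

Lemma cvg_iter_sign_step s : `|s| <= 1 ->
  iter n sign_step s @[n --> \oo] --> Num.sg s.
Proof.
have H u : 0 < u -> `|u| <= 1 -> iter n sign_step u @[n --> \oo] --> (1 : R).
  move=> u0; rewrite gtr0_norm// => u1.
  have hu n : _ := @iter_sign_step_itv n u (introT andP (conj (ltW u0) u1)).
  apply: (@squeeze_cvgr _ _ _ _ (fun n => 1 - (1 - u / 2) ^+ n) (cst 1)).
  - apply: nearW => n; have [/andP[_ ->] h] := hu n.
    by rewrite andbT lerBlDr -lerBlDl.
  - rewrite -[X in _ --> X]subr0; apply: cvgB; first exact: cvg_cst.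
    by apply: cvg_expr; rewrite ger0_norm; nra.
  - exact: cvg_cst.
have [s0|s0|->] := ltgtP s 0; last first.
- rewrite sgr0 (_ : (fun _ => _) = cst 0); first by move=> _; exact: cvg_cst.
  by apply/funext; elim=> //= n ->; rewrite /sign_step mul0r mul0r.
- by rewrite gtr0_sg//; exact: H.
- rewrite ltr0_sg// -normrN => s1.
  rewrite (_ : (fun _ => _) = (fun n => - iter n sign_step (- s))).
    by apply: cvgN; apply: H => //; rewrite oppr_gt0.
  by apply/funext => n; rewrite iter_sign_stepN opprK.
Qed.

(* [s * (s + 1) / 2] sends the signs -1, 0, 1 to 0, 0, 1. *)
Definition pos_approx n m y :=
  let s := iter n sign_step (sin (y / m.+1%:R)) in s * (s + 1) / 2.

Lemma pos_approx_norm n m y : `|pos_approx n m y| <= 1.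
Proof.
rewrite /pos_approx; set s := iter _ _ _.
have : `|s| <= 1.
  by apply: iter_sign_step_norm; rewrite norm_sin_le1.
by rewrite !ler_norml => /andP[h1 h2]; apply/andP; split; nra.
Qed.

Lemma cvg_pos_approx m y : let s := Num.sg (sin (y / m.+1%:R)) in
  pos_approx n m y @[n --> \oo] --> s * (s + 1) / 2.
Proof.
have h : `|sin (y / m.+1%:R)| <= 1 by rewrite norm_sin_le1.
have := cvg_iter_sign_step h => {}h.
apply: cvgM; last exact: cvg_cst.
by apply: cvgM => //; apply: cvgD => //; exact: cvg_cst.
Qed.

(** The sine makes the approximation periodic in [y]. Dividing by [m.+1] stretches the period: once
    [y / m.+1] lies strictly between [- pi] and [pi], its sine has the sign of [y]. *)
Lemma cvg_sg_sin y : let s m := Num.sg (sin (y / m.+1%:R)) in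
  s m * (s m + 1) / 2 @[m --> \oo] --> ((0 < y)%R%:R : R).
Proof.
move=> s; apply: cvg_near_cst.
have [N _ HN] := @nbhs_infty_gtr R `|y|.
suff E m : (N <= m)%N -> s m = Num.sg y.
  exists N => // m /= Nm; rewrite E//.
  have [y0|y0|->] := ltgtP y 0; last by rewrite sgr0 mul0r mul0r.
    by rewrite ltr0_sg// addNr mulr0 mul0r.
  by rewrite gtr0_sg// mul1r divff.
move=> Nm; rewrite /s.
have H u : 0 < u -> u <= `|y| -> 0 < sin (u / m.+1%:R).
  move=> u0 uy; apply: sin_gt0_pi; rewrite divr_gt0//=.
  rewrite ltr_pdivrMr// (le_lt_trans uy)//.
  have /lt_trans : `|y| < m%:R by exact: HN.
  apply; rewrite (@lt_le_trans _ _ m.+1%:R) ?ltr_nat//.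
  by rewrite ler_peMl// (le_trans _ (pi_ge2 _))// ler1n.
have [y0|y0|->] := ltgtP y 0; last by rewrite mul0r sin0.
- rewrite (ltr0_sg y0) ltr0_sg// -oppr_gt0 -sinN -mulNr.
  by apply: H; rewrite ?oppr_gt0// ltr0_norm.
- by rewrite !gtr0_sg//; apply: H => //; rewrite gtr0_norm.
Qed.

End sign_approximation.

(** * Trigonometric polynomials and half-spaces *)

Section trigonometric_uniqueness.
Context (R : realType) (T : Type) (L : set (T -> R)).
Hypothesis L0 : L (fun=> 0).
Hypothesis Llin : forall (c : R) l l', L l -> L l' -> L (fun t => c * l t + l' t).

(** The free phase [a] covers sines and constants, so that real functions suffice and products stay
    in the span. *)
Inductive trigpoly : (T -> R) -> Prop :=
| trigpoly_cos l a : L l -> trigpoly (fun t => cos (l t + a))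
| trigpoly_lin c f g : trigpoly f -> trigpoly g ->
    trigpoly (fun t => c * f t + g t).

Lemma trigpoly_cst c : trigpoly (fun=> c).
Proof.
have h0 : trigpoly (fun=> 0).
  rewrite (_ : (fun=> 0) = fun t : T => cos (0 + pi / 2)).
    exact: (trigpoly_cos (pi / 2) L0).
  by apply/funext => t; rewrite add0r cos_pihalf.
have := trigpoly_lin c (trigpoly_cos 0 L0) h0.
by congr trigpoly; apply/funext => t; rewrite !addr0 cos0 mulr1.
Qed.

Lemma trigpolyZ c f : trigpoly f -> trigpoly (fun t => c * f t).
Proof.
move=> hf; have := trigpoly_lin c hf (trigpoly_cst 0).
by congr trigpoly; apply/funext => t; rewrite addr0.
Qed.

Lemma trigpolyD f g : trigpoly f -> trigpoly g -> trigpoly (fun t => f t + g t).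
Proof.
move=> hf hg; have := trigpoly_lin 1 hf hg.
by congr trigpoly; apply/funext => t; rewrite mul1r.
Qed.

Lemma trigpolyM f g : trigpoly f -> trigpoly g -> trigpoly (fun t => f t * g t).
Proof.
move=> hf; elim: hf g => {f} [l a Ll|c f1 f2 _ IH1 _ IH2] g hg; last first.
  have := trigpoly_lin c (IH1 _ hg) (IH2 _ hg).
  by congr trigpoly; apply/funext => t; rewrite mulrDl mulrA.
elim: hg => {g} [l' a' Ll'|c g1 g2 _ IH1 _ IH2]; last first.
  have := trigpoly_lin c IH1 IH2.
  by congr trigpoly; apply/funext => t; rewrite mulrDr mulrCA.
have h1 : trigpoly (fun t => cos ((l t + l' t) + (a + a'))).
  apply: trigpoly_cos; have := Llin 1 Ll Ll'; congr L.
  by apply/funext => t; rewrite mul1r.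
have h2 : trigpoly (fun t => cos ((l t - l' t) + (a - a'))).
  apply: trigpoly_cos; have := Llin (-1) Ll' Ll; congr L.
  by apply/funext => t; rewrite mulN1r addrC.
have := trigpolyZ 2^-1 (trigpolyD h1 h2); congr trigpoly; apply/funext => t.
rewrite [X in cos X + _](_ : _ = (l t + a) + (l' t + a')); last by ring.
rewrite [X in _ + cos X](_ : _ = (l t + a) - (l' t + a')); last by ring.
rewrite cosD cosB; by field.
Qed.

Lemma trigpoly_pos_approx n m l a : L l ->
  trigpoly (fun t => pos_approx n m (l t - a)).
Proof.
move=> Ll; have h0 : trigpoly (fun t => sin ((l t - a) / m.+1%:R)).
  have := @trigpoly_cos (fun t => m.+1%:R^-1 * l t + 0) (- (a / m.+1%:R) - pi / 2).
  move=> /(_ (Llin _ Ll L0)); congr trigpoly; apply/funext => t.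
  rewrite -[RHS]cosBpihalf; congr cos; ring.
have hn : trigpoly (fun t => iter n (@sign_step R) (sin ((l t - a) / m.+1%:R))).
  elim: n => //= n IH.
  have IH2 := trigpolyM IH IH.
  have := trigpolyZ 2^-1 (trigpolyM IH (trigpoly_lin (-1) IH2 (trigpoly_cst 3))).
  congr trigpoly; apply/funext => t; rewrite /sign_step; ring.
have := trigpolyZ 2^-1 (trigpolyM hn (trigpolyD hn (trigpoly_cst 1))).
by congr trigpoly; apply/funext => t; rewrite /pos_approx; ring.
Qed.

Definition halfspaces (s : seq ((T -> R) * R)) : set T :=
  [set t | all (fun p => p.2 < p.1 t) s].


Fixpoint all_in (s : seq ((T -> R) * R)) : Prop :=
  if s is p :: s' then L p.1 /\ all_in s' else True.

Definition cylinders : set (set T) := halfspaces @` all_in.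

Lemma cylinders_setI : setI_closed cylinders.
Proof.
move=> _ _ [s Ls <-] [s' Ls' <-]; exists (s ++ s').
  by elim: s Ls => //= p s IH [? /IH].
by apply/seteqP; split => t; rewrite /halfspaces/= all_cat => /andP.
Qed.

Definition halfspaces_approx n m (s : seq ((T -> R) * R)) t : R :=
  \prod_(p <- s) pos_approx n m (p.1 t - p.2).

Lemma trigpoly_halfspaces_approx n m s : all_in s ->
  trigpoly (halfspaces_approx n m s).
Proof.
rewrite /halfspaces_approx; elim: s => [_|p s IH /= [Lp /IH hs]].
  have := trigpoly_cst 1; congr trigpoly.
  by apply/funext => t; rewrite big_nil.
have := trigpolyM (trigpoly_pos_approx n m p.2 Lp) hs; congr trigpoly.
by apply/funext => t; rewrite big_cons.
Qed.

Lemma halfspaces_approx_norm n m s t : `|halfspaces_approx n m s t| <= 1.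
Proof.
rewrite normr_prod; apply: prodr_ile1 => p _.
by rewrite normr_ge0 pos_approx_norm.
Qed.

Let sg2 (y : R) m := Num.sg (sin (y / m.+1%:R)).

Lemma cvg_halfspaces_approx m s t :
  halfspaces_approx n m s t @[n --> \oo] -->
  \prod_(p <- s) (let x := sg2 (p.1 t - p.2) m in x * (x + 1) / 2).
Proof.
rewrite /halfspaces_approx; elim: s => [|p s IH].
  by under eq_fun do rewrite big_nil; rewrite big_nil; exact: cvg_cst.
under eq_fun do rewrite big_cons; rewrite big_cons; apply: cvgM => //.
exact: cvg_pos_approx.
Qed.

Lemma cvg_halfspaces_indic s t :
  \prod_(p <- s) (let x := sg2 (p.1 t - p.2) m in x * (x + 1) / 2)
    @[m --> \oo] --> (\1_(halfspaces s) t : R).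
Proof.
have -> : \1_(halfspaces s) t = \prod_(p <- s) (0 < p.1 t - p.2)%R%:R :> R.
  rewrite indicE; elim: s => [|p s IH]; first by rewrite big_nil mem_set.
  rewrite big_cons -IH -natrM mulnb; congr (nat_of_bool _)%:R.
  rewrite subr_gt0; apply/idP/andP; last first.
    by move=> [h /set_mem hs]; apply/mem_set; rewrite /halfspaces/= h.
  by move=> /set_mem/= /andP[h hs]; split=> //; exact/mem_set.
elim: s => [|p s IH].
  by under eq_fun do rewrite big_nil; rewrite big_nil; exact: cvg_cst.
under eq_fun do rewrite big_cons; rewrite big_cons; apply: cvgM => //.
exact: cvg_sg_sin.
Qed.

Context d (Om : measurableType d) (P : probability Om R).
Variables (V1 V2 : Om -> T) (w1 w2 : Om -> R).
Hypothesis mV1 : forall l, L l -> measurable_fun setT (l \o V1).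
Hypothesis mV2 : forall l, L l -> measurable_fun setT (l \o V2).
Hypothesis iw1 : P.-integrable setT (EFin \o w1).
Hypothesis iw2 : P.-integrable setT (EFin \o w2).

(** The measures [w1 P] and [w2 P], pushed forward by [V1] and [V2], integrate [f] alike.
    Measurability is asked after composition because [T] carries no sigma-algebra here. The weights
    may change sign; later some of them are cosines. *)
Definition transfer (f : T -> R) : Prop :=
  [/\ measurable_fun setT (f \o V1), measurable_fun setT (f \o V2) &
      \int[P]_w (f (V1 w) * w1 w) = \int[P]_w (f (V2 w) * w2 w)].

Lemma transfer_lin (M : R) c f g : transfer f -> transfer g ->
  (forall t, `|f t| <= M) -> (forall t, `|g t| <= M) ->
  transfer (fun t => c * f t + g t).
Proof.
move=> [mf1 mf2 fE] [mg1 mg2 gE] fM gM; split.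
- by apply: measurable_funD => //; exact: measurable_funM.
- by apply: measurable_funD => //; exact: measurable_funM.
have if1 := integrable_boundedM mf1 (fun x => fM (V1 x)) iw1.
have if2 := integrable_boundedM mf2 (fun x => fM (V2 x)) iw2.
have ig1 := integrable_boundedM mg1 (fun x => gM (V1 x)) iw1.
have ig2 := integrable_boundedM mg2 (fun x => gM (V2 x)) iw2.
have E (V : Om -> T) w : P.-integrable setT (EFin \o (fun x => f (V x) * w x)) ->
    P.-integrable setT (EFin \o (fun x => g (V x) * w x)) ->
    \int[P]_x ((c * f (V x) + g (V x)) * w x) =
    c * \int[P]_x (f (V x) * w x) + \int[P]_x (g (V x) * w x).
  move=> hf hg; rewrite -RintegralZl// -RintegralD//.
    by apply: eq_Rintegral => x _; rewrite mulrDl mulrA.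
  exact: (integrableZl measurableT c hf).
by rewrite !E// fE gE.
Qed.

Lemma transfer_cvg (M : R) (f_ : nat -> T -> R) f : (forall n, transfer (f_ n)) ->
  (forall n t, `|f_ n t| <= M) -> (forall t, f_ n t @[n --> \oo] --> f t) ->
  transfer f.
Proof.
move=> tf fM cf.
have H (V : Om -> T) w : (forall n, measurable_fun setT (f_ n \o V)) ->
    P.-integrable setT (EFin \o w) -> measurable_fun setT (f \o V) /\
    \int[P]_x (f_ n (V x) * w x) @[n --> \oo] --> \int[P]_x (f (V x) * w x).
  move=> mf iw; have mw := integrable_measurable iw; split.
    by apply: (measurable_fun_cvg (h := fun n => f_ n \o V)) => // x _; exact: cf.
  apply: (@dominated_Rintegral _ _ _ P (fun n x => f_ n (V x) * w x)
    (fun x => f (V x) * w x) (fun x => M * `|w x|) _ _ _ _).2.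
  - by move=> n; apply: measurable_funM => //; exact: mf.
  - by move=> x; apply: cvgM; [exact: cf|exact: cvg_cst].
  - exact: (integrableZl measurableT M (integrable_norm iw)).
  - by move=> n x; rewrite normrM ler_wpM2r.
have [mf1 cf1] := H _ _ (fun n => let: And3 h _ _ := tf n in h) iw1.
have [mf2 cf2] := H _ _ (fun n => let: And3 _ h _ := tf n in h) iw2.
split=> //; apply: (cvg_unique _ cf1) => //.
rewrite (_ : (fun n => _) = (fun n => \int[P]_x (f_ n (V2 x) * w2 x))) //.
by apply/funext => n; have [] := tf n.
Qed.

Hypothesis cosE : forall l a, L l ->
  \int[P]_w (cos (l (V1 w) + a) * w1 w) = \int[P]_w (cos (l (V2 w) + a) * w2 w).

Lemma transfer_trigpoly f : trigpoly f -> transfer f.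
Proof.
suff H : trigpoly f -> transfer f /\ exists M, forall t, `|f t| <= M by move=> /H[].
elim=> {f} [l a Ll|c f g _ [tf [M fM]] _ [tg [N gN]]].
  split; last by exists 1 => t; rewrite ler_norml cos_geN1 cos_le1.
  split; [| |exact: cosE].
  - apply: (measurableT_comp (@measurable_cos R)).
    by apply: measurable_funD => //; exact: mV1.
  - apply: (measurableT_comp (@measurable_cos R)).
    by apply: measurable_funD => //; exact: mV2.
split.
  apply: (@transfer_lin (Num.max M N)) => // t.
    by rewrite (le_trans (fM t))// le_max lexx.
  by rewrite (le_trans (gN t))// le_max lexx orbT.
exists (`|c| * M + N) => t; rewrite (le_trans (ler_normD _ _))// lerD//.
by rewrite normrM ler_wpM2l.
Qed.

(** Two successive bounded limits: [n] tends to infinity at fixed [m], giving signs of sines, and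
    only then does [m]. *)
Lemma transfer_halfspaces s : all_in s -> transfer \1_(halfspaces s).
Proof.
move=> Ls; pose G m t := \prod_(p <- s) (let x := sg2 (p.1 t - p.2) m in x * (x + 1) / 2).
apply: (@transfer_cvg 1 G) => [m|m t|t]; last exact: cvg_halfspaces_indic.
  apply: (@transfer_cvg 1 (fun n => halfspaces_approx n m s)) => [n|n t|t].
  - exact: transfer_trigpoly (trigpoly_halfspaces_approx n m Ls).
  - exact: halfspaces_approx_norm.
  - exact: cvg_halfspaces_approx.
rewrite normr_prod; apply: prodr_ile1 => p _; rewrite normr_ge0/=.
rewrite normrM [`|2^-1|]ger0_norm// ler_pdivrMr// mul1r normrM.
set x := sg2 _ _; have x1 : `|x| <= 1 by rewrite /x /sg2 normr_sg lern1 leq_b1.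
rewrite -[leRHS]mul1r ler_pM// (le_trans (ler_normD _ _))//.
by rewrite normr1 lerD2r.
Qed.

Lemma transfer_indic C : <<s cylinders >> C -> transfer \1_C.
Proof.
have indic1 (A : set T) t : `|\1_A t : R| <= 1.
  by rewrite indicE; case: (_ \in _); rewrite ?normr1 ?normr0.
suff: <<s cylinders >> `<=` [set A | transfer \1_A] by exact.
apply: lambda_system_subset => //; first exact: cylinders_setI.
  split => //.
  (* The whole space is the intersection of the empty list of half-spaces. *)
  - by have := @transfer_halfspaces [::] I; congr (transfer \1__); apply/seteqP.
  - move=> A B BA tA tB; have := transfer_lin (-1) tB tA (indic1 _) (indic1 _).
    congr transfer; apply/funext => t; rewrite mulN1r !indicE in_setD addrC.
    have [tB'|tB'] := boolP (t \in B); last by rewrite andbT subr0.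
    by rewrite (mem_set (BA _ (set_mem tB'))) subrr.
  - move=> F Fnd tF; apply: (transfer_cvg (M := 1)) => [n|n t|t]; [exact: tF|exact: indic1|].
    rewrite !indicE; have [/set_mem[n _ Fn]|tF'] := boolP (t \in \bigcup_i F i).
      apply: cvg_near_cst; exists n => // k /= nk; rewrite indicE mem_set//.
      by have /subsetPset := Fnd _ _ nk; exact.
    apply: cvg_near_cst; apply: nearW => n; rewrite indicE memNset//.
    by move=> Fn; move/negP: tF'; apply; apply/mem_set; exists n.
by move=> _ [s Ls <-]; exact: transfer_halfspaces.
Qed.

End trigonometric_uniqueness.

Section transfer_bounded.
Import HBNNSimple.

(** Adding [M] makes [f] nonnegative, so that increasing simple approximations are available. They
    stay below twice [|M|], and dominated convergence then applies although the weights are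
    signed. *)
Lemma transfer_bounded_measurable (R : realType) d' (T : measurableType d')
    d (Om : measurableType d) (P : probability Om R) (V1 V2 : Om -> T)
    (w1 w2 : Om -> R) (M : R) (f : T -> R) :
  P.-integrable setT (EFin \o w1) -> P.-integrable setT (EFin \o w2) ->
  (forall C, measurable C -> transfer P V1 V2 w1 w2 \1_C) ->
  measurable_fun setT f -> (forall t, `|f t| <= M) -> transfer P V1 V2 w1 w2 f.
Proof.
move=> iw1 iw2 tC mf fM.
have indic1 (A : set T) t : `|\1_A t : R| <= 1.
  by rewrite indicE; case: (_ \in _); rewrite ?normr1 ?normr0.
pose h t := (f t + M)%:E.
have mh : measurable_fun setT h.
  by apply/measurable_EFinP; apply: measurable_funD.
have h0 t : setT t -> (0 <= h t)%E.
  move=> _; rewrite lee_fin -lerBlDr sub0r.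
  by have := fM t; rewrite ler_norml => /andP[].
pose h_ := nnsfun_approx measurableT mh.
have h_M n t : `|h_ n t| <= `|M| + `|M|.
  rewrite ger0_norm//.
  have : ((h_ n t)%:E <= h t)%E by rewrite nnsfun_approxE; exact: le_approx.
  rewrite lee_fin => /le_trans; apply; apply: lerD; last exact: ler_norm.
  by rewrite (le_trans (ler_norm _))// (le_trans (fM t))// ler_norm.
have th : transfer P V1 V2 w1 w2 (fun t => fine (h t)).
  apply: (@transfer_cvg _ _ _ _ P V1 V2 w1 w2 iw1 iw2 (`|M| + `|M|)
    (fun n => h_ n : T -> R) (fun t => fine (h t)) _ _ _) => [n|n t|t]; last first.
  - exact: fine_cvg (cvg_nnsfun_approx measurableT mh h0 (I : setT t)).
  - exact: h_M.
  (* The bound travels with the induction over the values of [h_ n] because linear combinations are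
     transferred for bounded functions only. *)
  suff [N []] : exists N, transfer P V1 V2 w1 w2 (h_ n) /\ forall t : T, `|h_ n t| <= N.
    by [].
  rewrite (_ : (h_ n : T -> R) = fun t => \sum_(y <- finmap.enum_fset (fset_set (range (h_ n))))
      (y * \1_(h_ n @^-1` [set y]) t)).
    elim: (finmap.enum_fset _) => [|y s [N [tN gN]]].
      exists 0; split=> [|t]; last by rewrite big_nil normr0.
      have := tC set0 measurable0; congr transfer.
      by apply/funext => t; rewrite big_nil indic0.
    have ty : transfer P V1 V2 w1 w2 \1_(h_ n @^-1` [set y]).
      by apply: tC; rewrite -[X in measurable X]setTI; exact: measurable_funPT.
    exists (`|y| + N); split.
      have := transfer_lin iw1 iw2 (M := Num.max 1 N) y ty tN.
      under [X in _ -> transfer _ _ _ _ _ X]eq_fun do rewrite big_cons.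
      apply=> t; first by rewrite le_max indic1.
      by rewrite le_max gN orbT.
    move=> t; rewrite big_cons (le_trans (ler_normD _ _))// lerD//.
    by rewrite normrM ler_piMr.
  by apply/funext => t; rewrite fimfunE fsbig_finite.
have t1 : transfer P V1 V2 w1 w2 \1_setT := tC _ measurableT.
have := transfer_lin iw1 iw2 (M := Num.max 1 (`|M| + `|M|)) (- M) t1 th.
under [X in _ -> _ -> transfer _ _ _ _ _ X]eq_fun do
  rewrite indicT mulr1 addrC /= addrK.
apply=> t; first by rewrite le_max indic1.
rewrite le_max; apply/orP; right => /=.
rewrite (le_trans (ler_normD _ _))// lerD//.
by rewrite (le_trans (fM t))// ler_norm.
Qed.

End transfer_bounded.

(** * Borel sets of a Banach space and strong measurability *)

Section strong_measurability.
Context (R : realType) (E : normedModType R).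
Context d (Om : measurableType d).
Implicit Types (V s : Om -> E).

Lemma simple_fun_measurable_comp s (phi : E -> R) :
  simple_fun s -> measurable_fun setT (phi \o s).
Proof.
move=> [fs ms] _ Y mY; rewrite setTI.
rewrite (_ : _ @^-1` _ = \bigcup_(y in range s `&` phi @^-1` Y) s @^-1` [set y]).
  by apply: fin_bigcup_measurable => //; exact: finite_setIl.
apply/seteqP; split => [w Yw|w [y [_ Yy] wy]]; last by rewrite /= wy.
by exists (s w) => //; split => //; exists w.
Qed.

Lemma strongly_measurable_comp V (phi : E -> R) : continuous phi ->
  strongly_measurable setT V -> measurable_fun setT (phi \o V).
Proof.
move=> cphi [s ss sV]; apply: (measurable_fun_cvg (h := fun n => phi \o s n)).
  by move=> n; exact: simple_fun_measurable_comp.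
move=> w _; apply: (cvg_comp (fun n => s n w) phi); first exact: sV.
exact: cphi.
Qed.

(** The values of the approximating simple functions form a countable set whose closure contains the
    range of [V]; [y (n, k)] is the [k]-th value of the [n]-th function. *)
Lemma strongly_measurable_separable V : strongly_measurable setT V ->
  exists y : nat * nat -> E,
    forall w (e : R), 0 < e -> exists j, `|V w - y j| < e.
Proof.
move=> [s ss sV].
have /choice[S SE] n : exists S : seq E, range (s n) = [set` S].
  by apply/finite_seqP; have [] := ss n.
exists (fun p => nth 0 (S p.1) p.2) => w e e0.
have /cvgrPdist_lt/(_ _ e0)[n _ /(_ n (leqnn n)) hn] := sV w I.
exists (n, index (s n w) (S n)); rewrite /= nth_index//.
have : range (s n) (s n w) by exists w.
by rewrite SE.
Qed.

Lemma simple_funD s s' : simple_fun s -> simple_fun s' -> simple_fun (s \+ s').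
Proof.
move=> [fs ms] [fs' ms']; split.
  apply: (@sub_finite_set _ _ [set p.1 + p.2 | p in range s `*` range s']).
    by move=> _ [w _ <-]; exists (s w, s' w) => //; split => /=; exists w.
  by apply: finite_image; exact: finite_setX.
move=> y; rewrite (_ : _ @^-1` _ =
    \bigcup_(z in range s) (s @^-1` [set z] `&` s' @^-1` [set y - z])).
  by apply: fin_bigcup_measurable => // z _; exact: measurableI.
apply/seteqP; split => [w /= <-|w [z _ [/= sz s'z]]].
  by exists (s w); [exists w|split => //=; rewrite addrC addKr].
by rewrite sz s'z addrC subrK.
Qed.

Lemma simple_fun_cst (a : E) : simple_fun (cst a : Om -> E).
Proof.
split => [|y]; last by rewrite preimage_cst; case: ifP.
by apply: (@sub_finite_set _ _ [set a]) => // _ [w _ <-].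
Qed.

Lemma strongly_measurableD_cst V (a : E) : strongly_measurable setT V ->
  strongly_measurable setT (fun w => V w + a).
Proof.
move=> [s ss sV]; exists (fun n => s n \+ cst a).
  by move=> n; apply: simple_funD => //; exact: simple_fun_cst.
by move=> w _; apply: cvgD; [exact: sV|exact: cvg_cst].
Qed.

End strong_measurability.

Section cylinders_borel.
Context (R : realType) (E : normedModType R).

Definition functionals : set (E -> R) :=
  [set l | exists2 l' : {linear E -> R^o}, continuous l' & l = l' :> (E -> R)].

Lemma functionals0 : functionals (fun=> 0).
Proof.
exists (\0 : {linear E -> R^o}) => //.
exact: cst_continuous.
Qed.

Lemma functionals_lin (c : R) l l' : functionals l -> functionals l' ->
  functionals (fun t => c * l t + l' t).
Proof.
move=> [{}l cl ->] [{}l' cl' ->].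
exists ((c \*: l) \+ l' : {linear E -> R^o}) => // x.
by apply: cvgD; [apply: cvgZr; exact: cl|exact: cl'].
Qed.

Local Notation cyl := (g_sigma_algebraType (cylinders functionals)).

(** With [l i] norming [y i - y j], every [z] in the closure of the family satisfies
    [|z - y j| = sup_i l i (z - y j)]. On that closure the closed ball is thus a countable
    intersection of closed half-spaces, the complements of the [H i]. *)
Lemma cylinder_ball (I : countType) (y : I -> E) (j : I) (r : R) :
  exists2 C : set E, <<s cylinders functionals >> C &
    forall z, (forall e : R, 0 < e -> exists i, `|z - y i| < e) ->
      C z <-> `|z - y j| <= r.
Proof.
have /choice[l lP] i : exists l : {linear E -> R^o},
    [/\ continuous l, forall z, `|l z| <= `|z| & l (y i - y j) = `|y i - y j|].
  exact: norming_functional.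
pose H i := halfspaces [:: (l i : E -> R, r + l i (y j))].
have mH i : @measurable _ cyl (H i).
  apply: sub_sigma_algebra; exists [:: (l i : E -> R, r + l i (y j))] => //=.
  by split => //; exists (l i) => //; have [] := lP i.
exists (~` \bigcup_i H i).
  apply: (@measurableC _ cyl); apply: (@countable_bigcupT_measurable _ cyl) => //.
move=> z zy; have HE i : (~` H i) z <-> l i (z - y j) <= r.
  rewrite /H /halfspaces /= andbT linearB lerBlDr.
  by split => [/negP|h]; [rewrite -leNgt|apply/negP; rewrite -leNgt].
split => [Cz|zr [i _ Hz]]; last first.
  have [_ ll _] := lP i; have : (~` H i) z.
    by apply/HE; rewrite (le_trans (ler_norm _))// (le_trans (ll _)).
  exact.
apply/ler_addgt0Pr => e e0.
have [i zi] := zy (e / 2) (divr_gt0 e0 (ltr0n _ 2)).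
have [_ ll lij] := lP i.
have h1 : l i (z - y j) <= r by apply/HE => Hz; apply: Cz; exists i.
have h2 : `|y i - y j| <= l i (z - y j) + e / 2.
  rewrite -lij (_ : y i - y j = (z - y j) - (z - y i)); last first.
    by rewrite opprB addrCA addrAC subrr add0r.
  rewrite linearB lerD2l (le_trans _ (ltW zi))// -(normrN (z - _)) -linearN.
  by rewrite (le_trans (ler_norm _)).
have h3 : `|z - y j| <= `|z - y i| + `|y i - y j| by exact: ler_distD.
by lra.
Qed.

(** The sets on which [C] and [C'] agree near the family form a sigma-algebra. It contains every
    open [O]: on the closure of the family, [O] is the countable union of the balls with centres
    [y i] and radii [1 / (k + 1)] that [O] contains. *)
Lemma borel_cylinders (I : countType) (y : I -> E) (C : set E) :
  <<s @open E >> C ->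
  exists2 C' : set E, <<s cylinders functionals >> C' &
    forall z, (forall e : R, 0 < e -> exists i, `|z - y i| < e) -> C z <-> C' z.
Proof.
pose near z := forall e : R, 0 < e -> exists i, `|z - y i| < e.
suff : <<s @open E >> `<=` [set C | exists2 C' : set E,
    <<s cylinders functionals >> C' & forall z, near z -> C z <-> C' z].
  exact.
apply: smallest_sub.
  split.
  - by exists set0 => //; exact: (@measurable0 _ cyl).
  - move=> A [A' mA' AA']; exists (~` A'); first exact: (@measurableC _ cyl).
    move=> z nz; rewrite setTD /=.
    by split; apply: contra_not => /AA'; exact.
  - move=> F hF; have /choice[C' C'P] n : exists C', <<s cylinders functionals >> C' /\
        forall z, near z -> F n z <-> C' z.
      by have [C' mC' C'F] := hF n; exists C'.
    exists (\bigcup_n C' n).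
      by apply: (@bigcupT_measurable _ cyl) => n; have [] := C'P n.
    move=> z nz; split => -[n _ h]; exists n => //; have [_ C'F] := C'P n.
      exact/C'F.
    exact/(C'F z nz).
move=> O oO.
have /choice[B' B'P] (p : I * nat) : exists B' : set E,
    <<s cylinders functionals >> B' /\
    forall z, near z -> B' z <-> `|z - y p.1| <= p.2.+1%:R^-1.
  by have [B' ? ?] := cylinder_ball y p.1 p.2.+1%:R^-1; exists B'.
pose J (p : I * nat) := forall z, `|z - y p.1| <= p.2.+1%:R^-1 -> O z.
exists (\bigcup_p if `[< J p >] then B' p else set0).
  apply: (@countable_bigcupT_measurable _ cyl) => [|p]; first exact: countableP.
  by case: ifP => _; [have [] := B'P p|exact: (@measurable0 _ cyl)].
move=> z nz; split => [Oz|[p _]]; last first.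
  by case: asboolP => // Jp; have [_ B'E] := B'P p; move/(B'E _ nz)/Jp.
have /nbhs_ballP[e /= e0 zeO] : nbhs z O by exact: open_nbhs_nbhs.
have [k] := ltr_add_invr (divr_gt0 e0 (ltr0n _ 2)); rewrite add0r => ke.
have [j zj] := nz k.+1%:R^-1 (ltac:(by rewrite invr_gt0)).
exists (j, k) => //; case: asboolP => [_|nJ]; last first.
  case: nJ => u /= uj; apply: zeO; rewrite -ball_normE /=.
  have := ler_distD (y j) z u; rewrite (distrC (y j)).
  move=> /le_lt_trans; apply; rewrite (splitr e) ltrD//; first exact: lt_trans zj ke.
  exact: le_lt_trans uj ke.
by have [_ B'E] := B'P (j, k); apply/(B'E _ nz); exact: ltW.
Qed.

End cylinders_borel.

Lemma transfer_eq (R : realType) (T : Type) d (Om : measurableType d)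
    (P : probability Om R) (V1 V2 : Om -> T) (w1 w2 : Om -> R) (f g : T -> R) :
  (forall w, f (V1 w) = g (V1 w)) -> (forall w, f (V2 w) = g (V2 w)) ->
  transfer P V1 V2 w1 w2 f -> transfer P V1 V2 w1 w2 g.
Proof.
move=> fg1 fg2 [m1 m2 e]; split.
- by move: m1; congr measurable_fun; apply/funext.
- by move: m2; congr measurable_fun; apply/funext.
- by under eq_Rintegral do rewrite -fg1; under [RHS]eq_Rintegral do rewrite -fg2.
Qed.

Lemma transfer_cos_borel (R : realType) (E : normedModType R)
    d (Om : measurableType d) (P : probability Om R) (V1 V2 : Om -> E)
    (w1 w2 : Om -> R) (f : E -> R) :
  strongly_measurable setT V1 -> strongly_measurable setT V2 ->
  P.-integrable setT (EFin \o w1) -> P.-integrable setT (EFin \o w2) ->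
  (forall (l : {linear E -> R^o}) a, continuous l ->
    \int[P]_w (cos (l (V1 w) + a) * w1 w) = \int[P]_w (cos (l (V2 w) + a) * w2 w)) ->
  bounded_borel f -> transfer P V1 V2 w1 w2 f.
Proof.
move=> sV1 sV2 iw1 iw2 cosE [mf [M fM]].
apply: (@transfer_bounded_measurable _ _ (g_sigma_algebraType (@open E))
  _ _ _ _ _ _ _ M) => // C mC.
have [y1 y1P] := strongly_measurable_separable sV1.
have [y2 y2P] := strongly_measurable_separable sV2.
(* The same [C'] must replace [C] along both [V1] and [V2], so the two countable families are
   merged. *)
pose y (i : (nat * nat) + (nat * nat)) := match i with inl j => y1 j | inr j => y2 j end.
have [C' mC' CC'] := borel_cylinders y mC.
have indE z : C z <-> C' z -> \1_C' z = \1_C z :> R.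
  by move=> zC; rewrite !indicE; congr (nat_of_bool _)%:R; apply/idP/idP;
    move=> /set_mem/zC/mem_set.
apply: (@transfer_eq _ _ _ _ _ _ _ _ _ \1_C').
- move=> w; apply: indE; apply: CC' => e e0.
  by have [j hj] := y1P w e e0; exists (inl j).
- move=> w; apply: indE; apply: CC' => e e0.
  by have [j hj] := y2P w e e0; exists (inr j).
apply: (transfer_indic (@functionals0 _ E) (@functionals_lin _ E)) => //.
- by move=> _ [l cl ->]; exact: strongly_measurable_comp.
- by move=> _ [l cl ->]; exact: strongly_measurable_comp.
- by move=> _ a [l cl ->]; exact: cosE.
Qed.

(** On the line the open half-lines are already half-spaces, those of [fun t => 1 * t], and they
    generate the Borel sets. *)
Lemma transfer_cos_real (R : realType) d (Om : measurableType d)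
    (P : probability Om R) (X1 X2 : Om -> R) (w1 w2 : Om -> R) (M : R) (f : R -> R) :
  measurable_fun setT X1 -> measurable_fun setT X2 ->
  P.-integrable setT (EFin \o w1) -> P.-integrable setT (EFin \o w2) ->
  (forall u a, \int[P]_w (cos (u * X1 w + a) * w1 w) =
    \int[P]_w (cos (u * X2 w + a) * w2 w)) ->
  measurable_fun setT f -> (forall t, `|f t| <= M) -> transfer P X1 X2 w1 w2 f.
Proof.
move=> mX1 mX2 iw1 iw2 cosE mf fM.
apply: (transfer_bounded_measurable iw1 iw2 _ mf fM) => C mC.
pose L := [set l : R -> R | exists u, l = fun t => u * t].
have L0 : L (fun=> 0) by exists 0; apply/funext => t; rewrite mul0r.
have Llin (c : R) l l' : L l -> L l' -> L (fun t => c * l t + l' t).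
  move=> [u ->] [u' ->]; exists (c * u + u').
  by apply/funext => t; rewrite mulrDl mulrA.
apply: (transfer_indic L0 Llin) => //.
- by move=> _ [u ->]; exact: measurable_funM.
- by move=> _ [u ->]; exact: measurable_funM.
- by move=> _ a [u ->]; exact: cosE.
have {}mC : (@RGenOInfty.G R).-sigma.-measurable C.
  by rewrite -RGenOInfty.measurableE; exact: mC.
move: C mC; apply: smallest_sub.
  exact: smallest_sigma_algebra.
move=> _ [a ->]; apply: sub_sigma_algebra; exists [:: (fun t => 1 * t, a)].
  by split => //; exists 1.
apply/seteqP; split => t; rewrite /halfspaces/= in_itv/= !andbT mul1r //.
Qed.

(** * Gaussian variables *)

Section density.
Import HBNNSimple.

(** Serves to turn expectations under [normal_prob] into Lebesgue integrals against [normal_pdf],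
    where a change of variables is possible. *)
Lemma ge0_integral_density d (T : measurableType d) (R : realType)
    (mu nu : {measure set T -> \bar R}) (p f : T -> R) :
  measurable_fun setT p -> (forall x, 0 <= p x) ->
  (forall A, measurable A -> nu A = (\int[mu]_(x in A) (p x)%:E)%E) ->
  measurable_fun setT f -> (forall x, 0 <= f x) ->
  (\int[nu]_x (f x)%:E = \int[mu]_x (f x * p x)%:E)%E.
Proof.
move=> mp p0 nuE mf f0.
have mh : measurable_fun setT (EFin \o f) by exact/measurable_EFinP.
have h0 x : setT x -> (0 <= (EFin \o f) x)%E by rewrite lee_fin.
pose f_ := nnsfun_approx measurableT mh.
have mf_ n : measurable_fun setT (f_ n) by exact: measurable_funPT.
transitivity (limn (fun n => \int[nu]_x (f_ n x)%:E)%E).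
  rewrite -monotone_convergence//.
  - apply: eq_integral => y _; apply/esym/cvg_lim => //.
    exact: cvg_nnsfun_approx.
  - by move=> n; exact/measurable_EFinP.
  - by move=> n y _; rewrite lee_fin.
  - by move=> y _ i j ij; rewrite lee_fin; exact/lefP/nd_nnsfun_approx.
transitivity (limn (fun n => \int[mu]_x (f_ n x * p x)%:E)%E); last first.
  rewrite -monotone_convergence//.
  - apply: eq_integral => y _; apply/cvg_lim => //.
    under eq_fun do rewrite EFinM; rewrite EFinM; apply: cvgeZr => //.
    exact: cvg_nnsfun_approx.
  - by move=> n; apply/measurable_EFinP/measurable_funM.
  - by move=> n y _; rewrite lee_fin mulr_ge0.
  - move=> y _ i j ij; rewrite lee_fin ler_wpM2r//.
    exact/lefP/nd_nnsfun_approx.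
congr (limn _); apply/funext => n.
rewrite integralT_nnsfun sintegralE.
transitivity (\int[mu]_x \sum_(k \in range (f_ n))
    (k * (\1_(f_ n @^-1` [set k]) x * p x))%:E)%E; last first.
  apply: eq_integral => x _; rewrite fsumEFin//; congr EFin.
  rewrite [in RHS]fimfunE !fsbig_finite//= mulr_suml.
  by apply: eq_bigr => k _; rewrite mulrA.
have mk k : measurable (f_ n @^-1` [set k]).
  by rewrite -[X in measurable X]setTI; exact: mf_.
have m1 k : measurable_fun setT (fun x => \1_(f_ n @^-1` [set k]) x * p x).
  by apply: measurable_funM => //; exact: measurable_indic.
rewrite ge0_integral_fsum//; last 2 first.
- by move=> k; apply/measurable_EFinP; exact: measurable_funM.
- move=> k x _; rewrite mulrA lee_fin mulr_ge0//.
  exact: nnfun_muleindic_ge0.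
apply: eq_fsbigr => k /set_mem[y _ fk].
have k0 : 0 <= k by rewrite -fk.
rewrite nuE// integral_mkcond -ge0_integralZl//=.
- apply: eq_integral => x _; rewrite patchE indicE.
  by case: ifP => _; rewrite ?mul1r ?mul0r ?mulr0 ?mule0.
- apply/(measurable_restrictT _ _).1 => //; apply/measurable_EFinP.
  exact: measurable_funTS.
- by move=> x _; rewrite patchE; case: ifP => // _; rewrite lee_fin.
Qed.

End density.

(** * Exponential tilting of a Gaussian law *)

Section gaussian_tilt.
Context (R : realType).
Local Notation mu := (@lebesgue_measure R).

(** Completing the square: after the shift by [c * s ^+ 2] the terms linear in [x] cancel in the
    exponent. *)
Lemma normal_pdf_shift (s c x : R) : s != 0 ->
  expR (c * (x + c * s ^+ 2)) * normal_pdf 0 s (x + c * s ^+ 2) =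
  expR (c ^+ 2 * s ^+ 2 / 2) * normal_pdf 0 s x.
Proof.
move=> s0; rewrite !normal_pdfE// /normal_fun !subr0.
rewrite mulrCA [RHS]mulrCA; congr (_ * _); rewrite -!expRD; congr expR.
by field; rewrite s0.
Qed.

Lemma integral_normal_tilt (s c : R) (psi : R -> R) : s != 0 ->
  continuous psi -> (forall x, 0 <= psi x) ->
  (\int[mu]_x (psi x * expR (c * x) * normal_pdf 0 s x)%:E =
   (expR (c ^+ 2 * s ^+ 2 / 2))%:E *
   \int[mu]_x (psi (x + c * s ^+ 2) * normal_pdf 0 s x)%:E)%E.
Proof.
move=> s0 cpsi psi0.
pose F x : R := x + c * s ^+ 2.
have dF (x : R) : is_derive (x : R^o) (1 : R^o) (F : R^o -> R^o) (1 : R^o).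
  rewrite -[X in is_derive _ _ _ X]addr0; exact: is_deriveD.
have F'1 : (F : R^o -> R^o)^`()%classic = cst 1.
  by apply/funext => x; rewrite derive1E; exact: derive_val.
rewrite (@increasing_ge0_integration_by_substitutionT _ F
  (fun x => psi x * expR (c * x) * normal_pdf 0 s x)).
- rewrite -ge0_integralZl//=.
  + apply: eq_integral => x _; rewrite F'1 -EFinM; congr EFin => /=.
    rewrite /= fctE /cst/= mulr1 -mulrA normal_pdf_shift//; ring.
  + apply/measurable_EFinP; apply: measurable_funM; last exact: measurable_normal_pdf.
    apply: (measurableT_comp (continuous_measurable_fun cpsi)).
    exact: measurable_funD.
  + by move=> x _; rewrite lee_fin mulr_ge0// normal_pdf_ge0.
- by move=> x y xy; rewrite /F ltrD2r.
- by rewrite F'1; move=> x; exact: cvg_cst.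
- by rewrite F'1; exact: is_cvg_cst.
- by rewrite F'1; exact: is_cvg_cst.
- by move=> x; have [] := dF x.
- exact: cvg_addrr_Ny.
- exact: cvg_addrr.
- move=> x; apply: cvgM; last exact: continuous_normal_pdf.
  apply: cvgM; first exact: cpsi.
  apply: (cvg_comp (fun x => c * x) expR); last exact: continuous_expR.
  by apply: cvgM; [exact: cvg_cst|exact: cvg_id].
- by move=> x; rewrite !mulr_ge0 ?expR_ge0 ?normal_pdf_ge0.
Qed.

(** One-dimensional Cameron-Martin formula, and the only place where the law itself is used. For
    nonnegative [psi] it holds in the extended reals, so that [psi = 1] yields the exponential
    moments instead of presupposing them. A Dirac mass at 0 satisfies it with [v = 0]. *)
Lemma centred_gaussian_tilt d (Om : measurableType d) (P : probability Om R)
    (X : Om -> R) : centred_gaussian P X ->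
  exists2 v : R, 0 <= v & forall (c : R) (psi : R -> R), continuous psi -> (forall x, 0 <= psi x) ->
    (\int[P]_w (psi (X w) * expR (c * X w))%:E =
     (expR (c ^+ 2 * v / 2))%:E * \int[P]_w (psi (X w + c * v))%:E)%E.
Proof.
move=> [mX [s XE]]; exists (s ^+ 2); first exact: sqr_ge0.
move=> c psi cpsi psi0.
have mpsi := continuous_measurable_fun cpsi.
have mexp : measurable_fun [set: R] (fun x => expR (c * x)).
  by apply: measurableT_comp => //; exact: measurable_funM.
have mpe : measurable_fun [set: R] (fun x => psi x * expR (c * x)).
  exact: measurable_funM.
have mps : measurable_fun [set: R] (fun x => psi (x + c * s ^+ 2)).
  by apply: (measurableT_comp mpsi); exact: measurable_funD.
have pe0 x : 0 <= psi x * expR (c * x) by rewrite mulr_ge0 ?expR_ge0.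
pose X' : Om -> measurableTypeR R := X.
have mX' : measurable_fun setT X' := mX.
have push (f : measurableTypeR R -> R) : measurable_fun setT f -> (forall x, 0 <= f x) ->
    (\int[P]_w (f (X' w))%:E = \int[pushforward P X']_y (f y)%:E)%E.
  move=> mf f0; rewrite (ge0_integral_pushforward mX')//.
    exact/measurable_EFinP.
  by move=> y _; rewrite lee_fin.
rewrite (push _ mpe pe0) (push _ mps (fun x => psi0 _)).
have [s0|s0] := eqVneq s 0.
  have dE (f : measurableTypeR R -> R) : measurable_fun setT f ->
      (\int[pushforward P X']_y (f y)%:E = (f 0%R)%:E)%E.
    move=> mf; transitivity (\int[dirac (0%R : measurableTypeR R)]_y (f y)%:E)%E.
      apply: eq_measure_integral => A mA _.
      have XA : pushforward P X A = _ := XE A mA.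
      by move: XA; rewrite {1}s0 eqxx => XA; symmetry.
    rewrite integral_dirac//; last exact/measurable_EFinP.
    by rewrite diracT mul1e.
  rewrite (dE _ mpe) (dE _ mps) -EFinM s0 expr0n/= !mulr0 mul0r expR0 mulr1 mul1r.
  by rewrite addr0.
have nE (f : measurableTypeR R -> R) : measurable_fun setT f -> (forall x, 0 <= f x) ->
    (\int[pushforward P X']_y (f y)%:E = \int[mu]_y (f y * normal_pdf 0 s y)%:E)%E.
  move=> mf f0; transitivity (\int[normal_prob 0 s]_y (f y)%:E)%E.
    apply: eq_measure_integral => A mA _.
    have XA : pushforward P X A = _ := XE A mA.
    by move: XA; rewrite (negbTE s0) => XA; symmetry.
  apply: (@ge0_integral_density _ _ _ mu (normal_prob 0 s)) => //.
  - exact: measurable_normal_pdf.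
  - exact: normal_pdf_ge0.
rewrite (nE _ mpe pe0) (nE _ mps (fun x => psi0 _)).
exact: integral_normal_tilt.
Qed.

End gaussian_tilt.

(** * Exponential moments and derivatives of expectations *)

Section exponential_moments.
Context (R : realType) d (Om : measurableType d) (P : probability Om R).
Local Notation intble f := (P.-integrable setT (EFin \o f)).

Lemma is_derive_Rintegral (f df : R -> Om -> R) (G : Om -> R) (a r : R) : 0 < r ->
  (forall x, `|x - a| < r -> intble (f x)) ->
  (forall x w, `|x - a| < r -> is_derive x (1 : R) (fun y => f y w) (df x w)) ->
  intble G -> (forall x w, `|x - a| < r -> `|df x w| <= G w) ->
  is_derive a (1 : R) (fun x => \int[P]_w f x w) (\int[P]_w df a w).
Proof.
move=> r0 fi fd iG dG.
have I x : `]a - r, a + r[%classic x -> `|x - a| < r.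
  by rewrite /= in_itv/= ltr_distl.
have Ia : `]a - r, a + r[%classic a.
  by rewrite /= in_itv/= ltrBlDr !ltrDl r0.
have ra : `|a - a| < r by rewrite subrr normr0.
have G0 w : 0 <= G w by apply: (le_trans _ (dG a w ra)).
have d1 x w : `|x - a| < r -> partial1of2 f x w = df x w.
  move=> xa; rewrite partial1of2E; have h := fd x w xa.
  exact: derive_val.
have fi' x : `]a - r, a + r[%classic x -> intble (f x) by move=> /I; exact: fi.
have fd' x w : `]a - r, a + r[%classic x -> setT w -> derivable (f^~ w) x 1.
  by move=> /I xa _; have [] := fd x w xa.
have dG' x w : `]a - r, a + r[%classic x -> setT w -> `|partial1of2 f x w| <= G w.
  by move=> /I xa _; rewrite d1//; exact: dG.
have E := differentiation_under_integral measurableT Ia fi' fd' G0 iG dG'.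
have D : derivable (fun x => \int[P]_w f x w) a 1.
  exact: (derivable_under_integral measurableT Ia fi' fd' G0 iG dG').
apply: DeriveDef => //; rewrite -derive1E E.
by apply: eq_Rintegral => w _; rewrite d1.
Qed.

Lemma norm_le_expR (x : R) : `|x| <= expR x + expR (- x).
Proof.
have h1 := expR_ge1Dx x; have h2 := expR_ge1Dx (- x).
have h3 := expR_gt0 x; have h4 := expR_gt0 (- x).
by rewrite ler_norml; apply/andP; split; lra.
Qed.

Lemma expR_norm_le (x : R) : expR `|x| <= expR x + expR (- x).
Proof.
have h3 := expR_gt0 x; have h4 := expR_gt0 (- x).
have [x0|x0] := leP 0 x; first by rewrite ger0_norm// lerDl ltW.
by rewrite ltr0_norm// lerDr ltW.
Qed.

Variable X : Om -> R.

(** Asking this for all [c] at once makes the property stable under multiplication by [X], so that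
    derivatives in [c] can be iterated. *)
Definition exp_integrable (g : Om -> R) :=
  forall c, intble (fun w => g w * expR (c * X w)).

Lemma integrableD2 (f g : Om -> R) : intble f -> intble g -> intble (fun w => f w + g w).
Proof. by move=> hf hg; exact: (integrableD measurableT hf hg). Qed.

(** The square expands to [expR (2 x) + 2 + expR (- 2 x)], so the hypothesis on [g] at [c + 2], [c]
    and [c - 2] suffices. A square leaves room for two factors: a power of [X] and an exponential
    with exponent in [[- |X|, |X|]]. *)
Lemma exp_integrable_dominated (g h : Om -> R) :
  measurable_fun setT X -> measurable_fun setT h -> exp_integrable g ->
  (forall w, `|h w| <= `|g w| * (expR (X w) + expR (- X w)) ^+ 2) ->
  exp_integrable h.
Proof.
move=> mX mh ig hg c.
pose G w := `|g w * expR ((c + 2) * X w)| + 2 * `|g w * expR (c * X w)| +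
  `|g w * expR ((c - 2) * X w)|.
have iG : intble G.
  apply: integrableD2; last exact: integrable_norm (ig _).
  apply: integrableD2; first exact: integrable_norm (ig _).
  exact: (integrableZl measurableT 2 (integrable_norm (ig c))).
apply: (integrable_dominated _ iG).
  apply: measurable_funM => //; apply: measurableT_comp => //.
  exact: measurable_funM.
move=> w; rewrite normrM (gtr0_norm (expR_gt0 _)).
apply: (le_trans (ler_wpM2r (expR_ge0 _) (hg w))).
rewrite /G !normrM !(gtr0_norm (expR_gt0 _)) le_eqVlt; apply/orP; left; apply/eqP.
rewrite (_ : (c + 2) * X w = c * X w + X w + X w); last by ring.
rewrite (_ : (c - 2) * X w = c * X w + - X w + - X w); last by ring.
rewrite !expRD; have e : expR (- X w) * expR (X w) = 1 by rewrite -expRD addNr expR0.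
transitivity (`|g w| * expR (c * X w) * (expR (X w) ^+ 2 + expR (- X w) ^+ 2) +
   2 * (`|g w| * expR (c * X w)) * (expR (- X w) * expR (X w))); first by ring.
rewrite e; ring.
Qed.

Lemma exp_integrableMX (g : Om -> R) : measurable_fun setT X ->
  measurable_fun setT g -> exp_integrable g -> exp_integrable (fun w => g w * X w).
Proof.
move=> mX mg ig; apply: (exp_integrable_dominated mX _ ig).
  exact: measurable_funM.
move=> w; rewrite normrM ler_wpM2l// (le_trans (norm_le_expR _))//.
have h1 := expR_ge1Dx (X w); have h2 := expR_ge1Dx (- X w).
have h3 := expR_gt0 (X w); have h4 := expR_gt0 (- X w).
by rewrite expr2 ler_peMl//; lra.
Qed.

Lemma is_derive_exp_tilt (g : Om -> R) (a : R) : measurable_fun setT X ->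
  measurable_fun setT g -> exp_integrable g ->
  is_derive a (1 : R) (fun c => \int[P]_w (g w * expR (c * X w)))
    (\int[P]_w (g w * X w * expR (a * X w))).
Proof.
move=> mX mg ig.
have igX := exp_integrableMX mX mg ig.
have mgX : measurable_fun setT (fun w => g w * X w) by exact: measurable_funM.
(* In the domination of the derivative, one factor of the square bounds [X] and the other bounds
   [expR ((x - a) * X)] for [|x - a| < 1]. *)
pose h w := g w * (expR (X w) + expR (- X w)) ^+ 2.
have mh : measurable_fun setT h.
  apply: measurable_funM => //; apply: measurable_funX; apply: measurable_funD.
    exact: measurableT_comp.
  by apply: measurableT_comp => //; exact: measurableT_comp.
have ih : exp_integrable h.
  apply: (exp_integrable_dominated mX mh ig) => w.
  by rewrite normrM [X in _ * X <= _]ger0_norm// sqr_ge0.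
apply: (@is_derive_Rintegral (fun c w => g w * expR (c * X w))
  (fun c w => g w * X w * expR (c * X w)) (fun w => `|h w * expR (a * X w)|) a 1) => //;
  last 2 first.
- exact: integrable_norm (ih a).
- move=> x w xa; rewrite /h !normrM !(gtr0_norm (expR_gt0 _)).
  rewrite (_ : x * X w = (x - a) * X w + a * X w); last by ring.
  rewrite expRD !mulrA ler_wpM2r ?expR_ge0// -!mulrA ler_wpM2l//.
  rewrite [`|_ + _|]ger0_norm ?addr_ge0 ?expR_ge0// ler_pM ?expR_ge0// ?norm_le_expR//.
  apply: le_trans (expR_norm_le _); rewrite ler_expR (le_trans (ler_norm _))//.
  by rewrite normrM ler_piMl// ltW.
- move=> x w _.
  have dX : is_derive (x : R^o) (1 : R^o) (fun y => y * X w : R^o) (X w).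
    have := @is_deriveM R R^o id (cst (X w)) x 1 1 0 (is_derive_id _ _) (is_derive_cst _ _ _).
    by rewrite scaler0 add0r /GRing.scale/= mulr1.
  have := is_deriveZ (g w) (@is_derive1_comp _ expR (fun y => y * X w) x _ _
    (is_derive_expR (x * X w)) dX).
  by rewrite /GRing.scale/= mulrA mulrAC.
Qed.

End exponential_moments.

Section gaussian_tilt_consequences.
Context (R : realType) d (Om : measurableType d) (P : probability Om R).
Local Notation intble f := (P.-integrable setT (EFin \o f)).
Variables (X : Om -> R) (v : R).
Hypothesis mX : measurable_fun setT X.
Hypothesis tilt : forall (c : R) (psi : R -> R), continuous psi ->
  (forall x, 0 <= psi x) ->
  (\int[P]_w (psi (X w) * expR (c * X w))%:E =
   (expR (c ^+ 2 * v / 2))%:E * \int[P]_w (psi (X w + c * v))%:E)%E.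

Let expX c : intble (fun w => expR (c * X w)).
Proof.
apply/integrableP; split.
  by apply/measurable_EFinP/measurableT_comp => //; exact: measurable_funM.
rewrite (eq_integral (fun w => (1 * expR (c * X w))%:E)); last first.
  by move=> w _ /=; rewrite gtr0_norm ?expR_gt0// mul1r.
rewrite (@tilt c (fun=> 1)); [|exact: cst_continuous|by []].
by rewrite integral_cst// [X in (_ * (_ * X))%E]probability_setT !mule1 ltry.
Qed.

Lemma exp_integrable_bounded (M : R) (g : Om -> R) : measurable_fun setT g ->
  (forall w, `|g w| <= M) -> exp_integrable P X g.
Proof. by move=> mg gM c; exact: (integrable_boundedM mg gM (expX c)). Qed.

Lemma Rintegral_expX c : \int[P]_w expR (c * X w) = expR (c ^+ 2 * v / 2).
Proof.
transitivity (\int[P]_w (1 * expR (c * X w))).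
  by apply: eq_Rintegral => w _; rewrite mul1r.
rewrite /Rintegral (@tilt c (fun=> 1)); [|exact: cst_continuous|by []].
by rewrite integral_cst// [X in (_ * (_ * X))%E]probability_setT !mule1.
Qed.

Let mcos u a : measurable_fun setT (fun w => cos (u * X w + a)).
Proof.
apply: (measurableT_comp (@measurable_cos R)).
by apply: measurable_funD => //; exact: measurable_funM.
Qed.

Let icos u a : intble (fun w => cos (u * X w + a)).
Proof. exact: (integrable_bounded P (mcos u a) (fun w => norm_cos_le1 _)). Qed.

(** The tilt identity takes nonnegative functions only; it is applied to [1 + cos], and the
    contribution of 1 is subtracted. *)
Lemma Rintegral_cos_tilt c u a :
  \int[P]_w (cos (u * X w + a) * expR (c * X w)) =
  expR (c ^+ 2 * v / 2) * \int[P]_w cos (u * X w + (u * c * v + a)).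
Proof.
have icosexp : intble (fun w => cos (u * X w + a) * expR (c * X w)).
  exact: (exp_integrable_bounded (mcos u a) (fun w => norm_cos_le1 _)).
have i1 : intble (fun=> 1 : R) by exact: finite_measure_integrable_cst.
have E1 : \int[P]_w ((1 + cos (u * X w + a)) * expR (c * X w)) =
    expR (c ^+ 2 * v / 2) + \int[P]_w (cos (u * X w + a) * expR (c * X w)).
  rewrite -Rintegral_expX -RintegralD//.
  by apply: eq_Rintegral => w _; rewrite mulrDl mul1r.
have E2 : \int[P]_w (1 + cos (u * (X w + c * v) + a)) =
    1 + \int[P]_w cos (u * X w + (u * c * v + a)).
  rewrite -[X in X + _](_ : \int[P]_w (cst 1 w) = 1); last first.
    by rewrite Rintegral_cst// [X in fine X]probability_setT mulr1.
  rewrite -RintegralD//.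
  by apply: eq_Rintegral => w _; congr (_ + cos _); ring.
suff : \int[P]_w ((1 + cos (u * X w + a)) * expR (c * X w)) =
    expR (c ^+ 2 * v / 2) * \int[P]_w (1 + cos (u * (X w + c * v) + a)).
  by rewrite E1 E2 mulrDr mulr1 => /addrI.
have ctn : continuous (fun x => 1 + cos (u * x + a) : R).
  move=> x; apply: cvgD; first exact: cvg_cst.
  apply: (cvg_comp (fun x => u * x + a) cos); last exact: continuous_cos.
  apply: cvgD; last exact: cvg_cst.
  by apply: cvgM; [exact: cvg_cst|exact: cvg_id].
have psi0 x : 0 <= 1 + cos (u * x + a) by have := cos_geN1 (u * x + a); lra.
rewrite /Rintegral (tilt c ctn psi0).
rewrite fineM//; apply: (integrable_fin_num measurableT).
apply: integrableD2 => //.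
have := icos u (u * c * v + a); congr (P.-integrable _ _); apply/funext => w /=.
by congr (EFin (cos _)); ring.
Qed.

Let msin u a : measurable_fun setT (fun w => sin (u * X w + a)).
Proof.
apply: (measurableT_comp (@measurable_sin R)).
by apply: measurable_funD => //; exact: measurable_funM.
Qed.

Let isin u a : intble (fun w => sin (u * X w + a)).
Proof.
apply: (integrable_bounded P (msin u a) (M := 1)) => w.
by rewrite norm_sin_le1.
Qed.

(** Stein's identity [E (g(X) X) = v E (g'(X))] for a cosine [g]: both sides of the tilt identity
    are differentiated in [c] at 0. *)
Lemma Rintegral_cos_mulX u a :
  \int[P]_w (cos (u * X w + a) * X w) = - (u * v) * \int[P]_w sin (u * X w + a).
Proof.
set A := \int[P]_w cos (u * X w + a); set B := \int[P]_w sin (u * X w + a).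
have h2 : is_derive (0 : R) (1 : R) (fun c : R => expR (c ^+ 2 * (v / 2)) *
    (A * cos (c * (u * v)) - B * sin (c * (u * v))) : R) (- (u * v) * B).
  apply: is_derive_eq; rewrite /GRing.scale/=. rewrite expr0n/= !mul0r expR0 sin0 cos0; ring.
have h1 := is_derive_exp_tilt 0 mX (mcos u a)
  (exp_integrable_bounded (mcos u a) (fun w => norm_cos_le1 _)).
have E : (fun c => \int[P]_w (cos (u * X w + a) * expR (c * X w))) =
    (fun c => expR (c ^+ 2 * (v / 2)) * (A * cos (c * (u * v)) - B * sin (c * (u * v)))).
  apply/funext => c; rewrite Rintegral_cos_tilt mulrA; congr (_ * _).
  rewrite /A /B -!RintegralZr//.
  rewrite -RintegralB//.
  - apply: eq_Rintegral => w _.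
    rewrite (_ : u * X w + _ = (u * X w + a) + c * (u * v)); last by ring.
    exact: cosD.
  - exact: (integrableZr measurableT (cos (c * (u * v))) (icos u a)).
  - exact: (integrableZr measurableT (sin (c * (u * v))) (isin u a)).
rewrite {}E in h1.
transitivity (\int[P]_w (cos (u * X w + a) * X w * expR (0 * X w))).
  by apply: eq_Rintegral => w _; rewrite mul0r expR0 mulr1.
by rewrite -(@derive_val _ _ _ _ _ _ _ h1) (@derive_val _ _ _ _ _ _ _ h2).
Qed.

Let m1 : measurable_fun [set: Om] (fun=> 1 : R).
Proof. exact: measurable_cst. Qed.

Let i1 : exp_integrable P X (fun=> 1).
Proof. by apply: (exp_integrable_bounded (M := 1)) => // w; rewrite normr1. Qed.

Let mX1 : measurable_fun [set: Om] (fun w => 1 * X w).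
Proof. exact: measurable_funM. Qed.

Let iX := exp_integrableMX mX m1 i1.

Lemma integrable_tiltX : intble X.
Proof.
have := exp_integrableMX mX m1 i1 0.
by congr (P.-integrable _ _); apply/funext => w /=; rewrite mul0r expR0 mulr1 mul1r.
Qed.

Lemma Rintegral_cos u a :
  \int[P]_w cos (u * X w + a) = cos a * expR (- (u ^+ 2 * v / 2)).
Proof.
(* Stein's identity gives [phi' = - u v phi]. *)
pose phi u := \int[P]_w cos (u * X w + a).
have dphi y : is_derive y (1 : R) phi (- (y * v) * phi y).
  have -> : - (y * v) * phi y = \int[P]_w (- sin (y * X w + a) * X w).
    transitivity (\int[P]_w (cos (y * X w + (a + pi / 2)) * X w)).
      rewrite Rintegral_cos_mulX; congr (_ * _); apply: eq_Rintegral => w _.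
      by rewrite addrA sinDpihalf.
    by apply: eq_Rintegral => w _; rewrite addrA cosDpihalf.
  apply: (@is_derive_Rintegral _ _ _ _ (fun u w => cos (u * X w + a))
    (fun u w => - sin (u * X w + a) * X w) (fun w => `|X w|) y 1) => //.
  - move=> x w _; apply: is_derive_eq; rewrite /GRing.scale/=; ring.
  - exact: integrable_norm integrable_tiltX.
  - move=> x w _; rewrite normrM ler_piMl// normrN.
    by rewrite norm_sin_le1.
have d0 y : is_derive y (1 : R) (fun u => phi u * expR (u ^+ 2 * (v / 2)) : R) 0.
  apply: is_derive_eq; rewrite /GRing.scale/=; by field.
have phi0 : phi 0 = cos a.
  rewrite /phi; under eq_Rintegral do rewrite mul0r add0r.
  by rewrite Rintegral_cst// [X in fine X]probability_setT mulr1.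
have E : phi u * expR (u ^+ 2 * (v / 2)) = cos a.
  have := is_derive_0_is_cst u 0 d0.
  by rewrite /= expr0n/= mul0r expR0 mulr1 phi0.
apply: (mulIf (lt0r_neq0 (expR_gt0 (u ^+ 2 * (v / 2))))).
by rewrite [LHS]E mulrA -[RHS]mulrA -expRD addNr expR0 mulr1.
Qed.

Lemma Rintegral_cos_expX c u a : 
  \int[P]_w (cos (u * X w + a) * expR (c * X w)) =
  expR ((c ^+ 2 - u ^+ 2) * v / 2) * cos (u * c * v + a).
Proof.
rewrite Rintegral_cos_tilt Rintegral_cos mulrCA -expRD mulrC.
by congr (expR _ * _); field.
Qed.

Lemma integrable_tilt_sqr : intble (fun w => X w ^+ 2).
Proof.
have := exp_integrableMX mX mX1 iX 0.
congr (P.-integrable _ _); apply/funext => w /=.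
by rewrite mul0r expR0 mulr1 mul1r.
Qed.

(** So far [v] is only the parameter of the tilt. Two derivatives of the moment generating function
    at 0 identify it with the second moment, which can be expanded for linear combinations. *)
Lemma Rintegral_tilt_sqr : \int[P]_w (X w ^+ 2) = v.
Proof.
have E1 c : \int[P]_w (1 * X w * expR (c * X w)) = c * v * expR (c ^+ 2 * (v / 2)).
  have h2 : is_derive c (1 : R) (fun c : R => expR (c ^+ 2 * (v / 2)) : R)
      (c * v * expR (c ^+ 2 * (v / 2))).
    apply: is_derive_eq; rewrite /GRing.scale/=; by field.
  have h1 := is_derive_exp_tilt c mX m1 i1.
  rewrite -(@derive_val _ _ _ _ _ _ _ h1) -(@derive_val _ _ _ _ _ _ _ h2).
  have E2 : (fun e : R => \int[P]_w (1 * expR (e * X w)) : R) =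
      (fun e : R => expR (e ^+ 2 * (v / 2)) : R).
    apply/funext => e; rewrite mulrA -Rintegral_expX.
    by apply: eq_Rintegral => w _; rewrite mul1r.
  by rewrite E2.
have h2 : is_derive 0 (1 : R) (fun c : R => c * v * expR (c ^+ 2 * (v / 2)) : R) v.
  apply: is_derive_eq; rewrite /GRing.scale/= expr0n/= !mul0r expR0; ring.
have h1 := is_derive_exp_tilt 0 mX mX1 iX.
rewrite -[RHS](@derive_val _ _ _ _ _ _ _ h2).
transitivity ('D_1 (fun c : R => \int[P]_w (1 * X w * expR (c * X w)) : R) (0 : R)).
  rewrite (@derive_val _ _ _ _ _ _ _ h1); apply: eq_Rintegral => w _.
  by rewrite /= mul0r expR0 mulr1 mul1r.
have E2 : (fun c : R => \int[P]_w (1 * X w * expR (c * X w)) : R) =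
  (fun c : R => c * v * expR (c ^+ 2 * (v / 2)) : R) by apply/funext => c; exact: E1.
by rewrite E2.
Qed.

End gaussian_tilt_consequences.

(** * Jointly Gaussian pairs *)

Section gaussian_pair.
Context (R : realType) d (Om : measurableType d) (P : probability Om R).
Local Notation intble f := (P.-integrable setT (EFin \o f)).
Local Notation Ex f := (\int[P]_w f w).

Lemma centred_gaussian_exp_integrable (X g : Om -> R) (M : R) :
  centred_gaussian P X -> measurable_fun setT g -> (forall w, `|g w| <= M) ->
  exp_integrable P X g.
Proof.
move=> gX mg gM; have [mX _] := gX; have [v v0 tilt] := centred_gaussian_tilt gX.
exact: (exp_integrable_bounded mX tilt mg gM).
Qed.

Lemma centred_gaussian_integrable (X : Om -> R) : centred_gaussian P X -> intble X.
Proof.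
move=> gX; have [mX _] := gX; have [v v0 tilt] := centred_gaussian_tilt gX.
exact: (integrable_tiltX mX tilt).
Qed.

Lemma centred_gaussian_sqr_integrable (X : Om -> R) :
  centred_gaussian P X -> intble (fun w => X w ^+ 2).
Proof.
move=> gX; have [mX _] := gX; have [v v0 tilt] := centred_gaussian_tilt gX.
exact: (integrable_tilt_sqr mX tilt).
Qed.

Lemma centred_gaussian_cos_exp (X : Om -> R) (c u a : R) : centred_gaussian P X ->
  \int[P]_w (cos (u * X w + a) * expR (c * X w)) =
  expR ((c ^+ 2 - u ^+ 2) * (\int[P]_w (X w ^+ 2)) / 2) *
  cos (u * c * (\int[P]_w (X w ^+ 2)) + a).
Proof.
move=> gX; have [mX _] := gX; have [v v0 tilt] := centred_gaussian_tilt gX.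
by rewrite (Rintegral_tilt_sqr mX tilt) (Rintegral_cos_expX mX tilt).
Qed.

Lemma centred_gaussian_cos (X : Om -> R) (a : R) : centred_gaussian P X ->
  \int[P]_w cos (X w + a) = expR (- (\int[P]_w (X w ^+ 2)) / 2) * cos a.
Proof.
move=> gX; have := centred_gaussian_cos_exp 0 1 a gX.
rewrite expr0n expr1n/= mulr0 mul0r !add0r mulN1r => <-.
by apply: eq_Rintegral => w _; rewrite mul1r mul0r expR0 mulr1.
Qed.

Variables (X Y : Om -> R).
Hypothesis gXY : forall u t : R, centred_gaussian P (fun w => u * X w + t * Y w).

Let gX : centred_gaussian P X.
Proof.
have := gXY 1 0; congr (centred_gaussian P); apply/funext => w.
by rewrite mul1r mul0r addr0.
Qed.

Let gY : centred_gaussian P Y.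
Proof.
have := gXY 0 1; congr (centred_gaussian P); apply/funext => w.
by rewrite mul1r mul0r add0r.
Qed.

Let mX : measurable_fun setT X. Proof. by have [] := gX. Qed.
Let mY : measurable_fun setT Y. Proof. by have [] := gY. Qed.

Lemma gaussian_pair_mul_integrable : intble (fun w => X w * Y w).
Proof.
apply: (@integrable_dominated _ _ _ _ _ (fun w => X w ^+ 2 + Y w ^+ 2)).
- exact: measurable_funM.
- by apply: integrableD2; exact: centred_gaussian_sqr_integrable.
- move=> w; rewrite ler_norml; apply/andP.
  have h1 := sqr_ge0 (X w + Y w); have h2 := sqr_ge0 (X w - Y w).
  have h3 := sqr_ge0 (X w); have h4 := sqr_ge0 (Y w).
  by split; nra.
Qed.

Let sg := Ex (fun w => X w ^+ 2).
Let c := Ex (fun w => X w * Y w).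
Let s := Ex (fun w => Y w ^+ 2).

Lemma gaussian_pair_variance u t :
  Ex (fun w => (u * X w + t * Y w) ^+ 2) = u ^+ 2 * sg + 2 * u * t * c + t ^+ 2 * s.
Proof.
have iX := centred_gaussian_sqr_integrable gX.
have iY := centred_gaussian_sqr_integrable gY.
have iXY := gaussian_pair_mul_integrable.
have iZ (k : R) f : intble f -> intble (fun w => k * f w).
  by move=> i; exact: (integrableZl measurableT k i).
have i1 := iZ (u ^+ 2) _ iX; have i3 := iZ (t ^+ 2) _ iY.
have i2 := iZ (2 * u * t) _ iXY; have i12 := integrableD2 i1 i2.
rewrite /sg /c /s -(RintegralZl _ _ iX)// -(RintegralZl _ _ iXY)//.
rewrite -(RintegralZl _ _ iY)// -(RintegralD _ i1 i2)// -(RintegralD _ i12 i3)//.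
by apply: eq_Rintegral => w _; ring.
Qed.

Let bet := c / s.

(* If [s = 0] then [bet = 0] by convention, and [c = 0] by Cauchy-Schwarz. *)
Let bets : bet * s = c.
Proof.
rewrite /bet; have [s0|s0] := eqVneq s 0; last by rewrite divfK.
rewrite s0 mulr0; apply/esym/eqP/negPn/negP => c0.
(* With [s = 0] the second moment of [X + t Y] is affine in [t], equal to [sg + 2 t c]; this [t]
   makes it -1. *)
have : 0 <= Ex (fun w => (1 * X w + (- (sg + 1) / (2 * c)) * Y w) ^+ 2).
  by apply: Rintegral_ge0 => w _; exact: sqr_ge0.
rewrite gaussian_pair_variance s0 mulr0 addr0.
rewrite (_ : 1 ^+ 2 * sg + _ = - 1); last by field.
by rewrite oppr_ge0 ler10.
Qed.

Let mcosX a : measurable_fun setT (fun w => cos (X w + a)).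
Proof.
apply: (measurableT_comp (@measurable_cos R)).
by apply: measurable_funD.
Qed.

Let mcosY t a : measurable_fun setT (fun w => cos (t * Y w + a)).
Proof.
apply: (measurableT_comp (@measurable_cos R)).
by apply: measurable_funD => //; exact: measurable_funM.
Qed.

Let cosM (x y : R) : cos x * cos y = 2^-1 * (cos (x + y) + cos (x - y)).
Proof. by rewrite cosD cosB; field. Qed.

(** [sg - c * bet] is the variance of the residual [X - bet * Y], which is uncorrelated with [Y];
    [k] is the characteristic function of the residual at 1. *)
Let k := expR (- (sg - c * bet) / 2).

Let icos (Z : Om -> R) a : centred_gaussian P Z -> intble (fun w => cos (Z w + a)).
Proof.
move=> gZ; apply: (integrable_bounded P (M := 1)) => [|w]; last exact: norm_cos_le1.
by apply: (measurableT_comp (@measurable_cos R)); apply: measurable_funD => //; have [] := gZ.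
Qed.

(** The product-to-sum formula leaves cosines of single linear combinations, whose laws are
    known. *)
Let Ecos2 (Z1 Z2 : Om -> R) a b :
  (forall t, centred_gaussian P (fun w => Z1 w + t * Z2 w)) ->
  Ex (fun w => cos (Z1 w + a) * cos (Z2 w + b)) = 2^-1 *
   (expR (- Ex (fun w => (Z1 w + 1 * Z2 w) ^+ 2) / 2) * cos (a + b) +
    expR (- Ex (fun w => (Z1 w + (-1) * Z2 w) ^+ 2) / 2) * cos (a - b)).
Proof.
move=> g; rewrite -!centred_gaussian_cos// -RintegralD//; [|exact: icos..].
rewrite -RintegralZl//; last by apply: integrableD2; exact: icos.
apply: eq_Rintegral => w _; rewrite cosM; congr (_ * (cos _ + cos _)); ring.
Qed.

(* [k * cos (bet * Y + a)] is the conditional expectation of [cos (X + a)] given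
   [Y]. *)
Lemma gaussian_pair_cos_transfer (M a : R) (psi : R -> R) :
  measurable_fun setT psi -> (forall y, `|psi y| <= M) ->
  Ex (fun w => psi (Y w) * cos (X w + a)) =
  Ex (fun w => psi (Y w) * (k * cos (bet * Y w + a))).
Proof.
move=> mpsi psiM.
have i1 : intble (fun w => cos (X w + a)) by exact: icos.
have i2 : intble (fun w => k * cos (bet * Y w + a)).
  apply: (integrableZl measurableT k (f := fun w => (cos (bet * Y w + a))%:E)).
  exact: (integrable_bounded P (mcosY bet a) (fun w => norm_cos_le1 _)).
(* Uniqueness on the line, with [Y] as both variables and with [cos (X + a)] and its conditional
   expectation as weights, reduces [psi] to a cosine. *)
suff cosE t b : Ex (fun w => cos (t * Y w + b) * cos (X w + a)) =
    Ex (fun w => cos (t * Y w + b) * (k * cos (bet * Y w + a))).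
  by have [_ _] := transfer_cos_real mY mY i1 i2 cosE mpsi psiM.
have gg u q : centred_gaussian P (fun w => u * Y w + q * (t * Y w)).
  have := gXY 0 (u + q * t); congr (centred_gaussian P); apply/funext => w; ring.
have gx q : centred_gaussian P (fun w => X w + q * (t * Y w)).
  have := gXY 1 (q * t); congr (centred_gaussian P); apply/funext => w; ring.
transitivity (Ex (fun w => cos (X w + a) * cos (t * Y w + b))).
  by apply: eq_Rintegral => w _; rewrite mulrC.
transitivity (k * Ex (fun w => cos (bet * Y w + a) * cos (t * Y w + b))); last first.
  rewrite -RintegralZl//; last first.
    apply: (integrable_bounded P (M := 1)) => // [|w]; first exact: measurable_funM.
    by rewrite normrM mulr_ile1// norm_cos_le1.
  by apply: eq_Rintegral => w _; ring.
rewrite (@Ecos2 X (fun w => t * Y w))// (@Ecos2 (fun w => bet * Y w) (fun w => t * Y w))//.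
have V1 q : Ex (fun w => (X w + q * (t * Y w)) ^+ 2) = sg + 2 * (q * t) * c + (q * t) ^+ 2 * s.
  have := gaussian_pair_variance 1 (q * t); rewrite expr1n mulr1 mul1r => <-.
  by apply: eq_Rintegral => w _; ring.
have V2 q : Ex (fun w => (bet * Y w + q * (t * Y w)) ^+ 2) = (bet + q * t) ^+ 2 * s.
  have := gaussian_pair_variance 0 (bet + q * t); rewrite expr0n/= mulr0 !mul0r !add0r => <-.
  by apply: eq_Rintegral => w _; ring.
rewrite mulrCA; congr (_ * _); rewrite mulrDr !mulrA.
have kE q : k * expR (- Ex (fun w => (bet * Y w + q * (t * Y w)) ^+ 2) / 2) =
    expR (- Ex (fun w => (X w + q * (t * Y w)) ^+ 2) / 2).
  rewrite /k -expRD; congr expR; rewrite V1 V2 -bets; by field.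
by rewrite !kE.
Qed.

Let iexpY e : intble (fun w => expR (e * Y w)).
Proof.
have m1 : measurable_fun [set: Om] (fun=> 1 : R) by exact: measurable_cst.
have := @centred_gaussian_exp_integrable _ _ 1 gY m1 (fun=> _) e.
under [X in _ -> P.-integrable _ X]eq_fun do rewrite /= -[expR _]mul1r.
by apply => _; rewrite normr1.
Qed.

(** Conditioning on [Y] is available for bounded functions of [Y] only; truncation extends it to the
    exponential. *)
Let cvg_min_expR (e : R) (g : Om -> R) :
  measurable_fun setT g -> (forall w, `|g w| <= 1) ->
  Ex (fun w => Num.min (expR (e * Y w)) n%:R * g w) @[n --> \oo] -->
  Ex (fun w => expR (e * Y w) * g w).
Proof.
move=> mg g1.
have mE : measurable_fun setT (fun w => expR (e * Y w)).
  by apply: measurableT_comp => //; exact: measurable_funM.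
apply: (@dominated_Rintegral _ _ _ P
  (fun n w => Num.min (expR (e * Y w)) n%:R * g w)
  (fun w => expR (e * Y w) * g w) (fun w => expR (e * Y w)) _ _ _ _).2 => //.
- by move=> n; apply: measurable_funM => //; exact: measurable_minr.
- move=> w; apply: cvgM; last exact: cvg_cst.
  apply: cvg_near_cst; have [N _ HN] := @nbhs_infty_ger R (expR (e * Y w)).
  by exists N => // n /= Nn; apply/min_idPl; exact: HN.
- move=> n w; have h0 : 0 <= Num.min (expR (e * Y w)) n%:R by rewrite le_min expR_ge0/= ler0n.
  rewrite normrM ger0_norm//.
  apply: (@le_trans _ _ (Num.min (expR (e * Y w)) n%:R)); last by rewrite ge_min lexx.
  by rewrite -[leRHS]mulr1 ler_wpM2l.
Qed.

(** After conditioning on [Y] only a one-dimensional tilt by [e * Y] remains. It moves the phase by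
    [bet * e * s = e * c], and the exponents combine to [- sg / 2] because
    [bet ^+ 2 * s = bet * c]. *)
Lemma gaussian_pair_cos_exp (e a : R) :
  Ex (fun w => cos (X w + a) * expR (e * Y w - e ^+ 2 * s / 2)) =
  Ex (fun w => cos (X w + (e * c + a))).
Proof.
have E1 : Ex (fun w => expR (e * Y w) * cos (X w + a)) =
    k * Ex (fun w => expR (e * Y w) * cos (bet * Y w + a)).
  pose u (n : nat) := Ex (fun w => Num.min (expR (e * Y w)) n%:R * cos (X w + a)).
  have c1 : u n @[n --> \oo] --> Ex (fun w => expR (e * Y w) * cos (X w + a)).
    by apply: cvg_min_expR => // w; exact: norm_cos_le1.
  suff uE : u = fun n : nat => k * Ex (fun w =>
      Num.min (expR (e * Y w)) n%:R * cos (bet * Y w + a)).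
    apply: (cvg_unique _ c1) => //; rewrite uE.
    by apply: cvgM; [exact: cvg_cst|]; apply: cvg_min_expR => // w;
      exact: norm_cos_le1.
  apply/funext => n; pose psi y := Num.min (expR (e * y)) n%:R.
  have mpsi : measurable_fun setT psi.
    apply: measurable_minr => //; apply: (measurableT_comp (@measurable_expR R)).
    exact: mulrl_measurable.
  have psin y : `|psi y| <= n%:R.
    have psi0 : 0 <= psi y by rewrite /psi le_min expR_ge0/= ler0n.
    by rewrite ger0_norm// /psi ge_min lexx orbT.
  apply: (etrans (gaussian_pair_cos_transfer a mpsi psin)).
  rewrite -RintegralZl//.
    by apply: eq_Rintegral => w _; rewrite /psi; ring.
  apply: (integrable_bounded P (M := n%:R)).
    by apply: measurable_funM => //; exact: (measurableT_comp mpsi mY).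
  by move=> w; rewrite normrM -[leRHS]mulr1 ler_pM// ?psin ?norm_cos_le1.
rewrite centred_gaussian_cos; last exact: gX.
transitivity (expR (- (e ^+ 2 * s / 2)) * Ex (fun w => expR (e * Y w) * cos (X w + a))).
  rewrite -RintegralZl//.
    by apply: eq_Rintegral => w _; rewrite expRD; ring.
  have := integrable_boundedM (mcosX a) (fun w => norm_cos_le1 _) (iexpY e).
  by congr (P.-integrable _ _); apply/funext => w /=; rewrite mulrC.
rewrite E1; transitivity (expR (- (e ^+ 2 * s / 2)) * (k *
    Ex (fun w => cos (bet * Y w + a) * expR (e * Y w)))).
  by congr (_ * (_ * _)); apply: eq_Rintegral => w _; rewrite mulrC.
rewrite centred_gaussian_cos_exp// !mulrA -!expRD; congr (expR _ * cos (_ + _)).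
  by rewrite -/sg -/s -bets; field.
by rewrite -/s -bets; ring.
Qed.

End gaussian_pair.

(** * Cameron-Martin and differentiation *)

Section cameron_martin.
Context (R : realType) (E : normedModType R).
Context d (Om : measurableType d) (P : probability Om R).
Variables (V : Om -> E) (Y : Om -> R) (m : E).
Hypothesis sV : strongly_measurable setT V.
Hypothesis gVY : forall l : {linear E -> R^o}, continuous l ->
  forall u t : R, centred_gaussian P (fun w => u * (l (V w) : R) + t * Y w).
Hypothesis covVY : forall l : {linear E -> R^o}, continuous l ->
  \int[P]_w ((l (V w) : R) * Y w) = l m.

Let s := \int[P]_w (Y w ^+ 2).

Let gY : centred_gaussian P Y.
Proof.
have := gVY (l := \0) (@cst_continuous _ _ _) 0 1; congr (centred_gaussian P).
by apply/funext => w; rewrite mul0r add0r mul1r.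
Qed.

Let mY : measurable_fun setT Y. Proof. by have [] := gY. Qed.

Let m1 : measurable_fun [set: Om] (fun=> 1 : R).
Proof. exact: measurable_cst. Qed.

(** The vector [m] is the weak form of [E (Y V)]: each [l (V)] has covariance [l m] with [Y], hence
    the density shifts its law by [e * l m], which is the effect of translating [V] by [e *: m]. *)
Lemma cameron_martin (f : E -> R) (e : R) : bounded_borel f ->
  measurable_fun setT (f \o V) /\
  \int[P]_w f (V w + e *: m) =
  \int[P]_w (f (V w) * expR (e * Y w - e ^+ 2 * s / 2)).
Proof.
move=> bf.
have sV' := strongly_measurableD_cst (e *: m) sV.
have i1 : P.-integrable setT (EFin \o (fun=> 1 : R)).
  by apply: (integrable_bounded P (M := 1)) => // w; rewrite normr1.
have iE : P.-integrable setT (EFin \o (fun w => expR (e * Y w - e ^+ 2 * s / 2))).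
  have h := centred_gaussian_exp_integrable (M := expR (- (e ^+ 2 * s / 2))) gY
    (g := fun=> expR (- (e ^+ 2 * s / 2))).
  have := h (measurable_cst _) _ e; rewrite /exp_integrable.
  under eq_fun do rewrite /= -expRD addrC.
  by apply => w; rewrite gtr0_norm// expR_gt0.
have [|_ mfV fE] := transfer_cos_borel sV' sV i1 iE _ bf.
  move=> l a cl; have h := gaussian_pair_cos_exp (gVY cl) e a.
  rewrite [RHS]h covVY//; apply: eq_Rintegral => w _.
  by rewrite mulr1 linearD linearZ /=; congr cos; rewrite addrA.
split => //; rewrite -fE; apply: eq_Rintegral => w _; by rewrite mulr1.
Qed.

(** As [f] is merely Borel, [e] has to leave its argument before differentiation. The normalising
    factor [expR (- e ^+ 2 * s / 2)] has zero derivative at 0, so only [Y] survives. *)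
Lemma is_derive_cameron_martin (f : E -> R) : bounded_borel f ->
  is_derive (0 : R) (1 : R) (fun e => \int[P]_w f (V w + e *: m) : R)
    (\int[P]_w (f (V w) * Y w)).
Proof.
move=> bf; have [_ [M fM]] := bf.
have mfV := (cameron_martin 0 bf).1.
have ifV := centred_gaussian_exp_integrable gY mfV (fun w => fM (V w)).
have h1 := is_derive_exp_tilt 0 mY mfV ifV.
pose G e := \int[P]_w (f (V w) * expR (e * Y w)).
have h2 : is_derive (0 : R) (1 : R) (fun e => expR (e ^+ 2 * (- (s / 2))) * G e : R)
    (\int[P]_w (f (V w) * Y w * expR (0 * Y w))).
  apply: is_derive_eq; rewrite /GRing.scale/= expr0n/= mul0r expR0.
  by set I := \int[P]_w _; ring.
have -> : (fun e => \int[P]_w f (V w + e *: m)) =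
    (fun e => expR (e ^+ 2 * (- (s / 2))) * G e).
  apply/funext => e; rewrite (cameron_martin e bf).2 /G -RintegralZl//.
    apply: eq_Rintegral => w _; rewrite expRD.
    by rewrite (_ : e ^+ 2 * (- (s / 2)) = - (e ^+ 2 * s / 2)); ring.
have -> : \int[P]_w (f (V w) * Y w) = \int[P]_w (f (V w) * Y w * expR (0 * Y w)).
  by apply: eq_Rintegral => w _; rewrite mul0r expR0 mulr1.
exact: h2.
Qed.

End cameron_martin.

(** * Inner products of square-integrable functions *)

Section inner_product_measurability.
Context (R : realType) (H : normedModType R) (ip : {dot H for idfun}).
Hypothesis ip_norm : induces_norm ip.

Lemma dot_sym (u v : H) : ip u v = ip v u.
Proof. by rewrite [LHS](hermC ip) expr0 mul1r. Qed.

Lemma dot_normD (u v : H) :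
  `|u + v| ^+ 2 = `|u| ^+ 2 + 2 * ip u v + `|v| ^+ 2.
Proof.
rewrite -!ip_norm linearDl /= !linearDr /= (dot_sym v u); ring.
Qed.

Lemma dot_normB (u v : H) :
  `|u - v| ^+ 2 = `|u| ^+ 2 - 2 * ip u v + `|v| ^+ 2.
Proof. rewrite dot_normD normrN linearNr /=; ring. Qed.

Lemma dot_polarization (u v : H) :
  ip u v = (`|u + v| ^+ 2 - `|u - v| ^+ 2) / 4.
Proof. by rewrite dot_normD dot_normB; field. Qed.

(** A crude substitute for Cauchy-Schwarz, sufficient for integrability of inner products. *)
Lemma dot_norm_le (u v : H) : `|ip u v| <= `|u| ^+ 2 + `|v| ^+ 2.
Proof.
have h1 := sqr_ge0 `|u + v|; have h2 := sqr_ge0 `|u - v|.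
rewrite dot_normD in h1; rewrite dot_normB in h2.
have h3 := sqr_ge0 `|u|; have h4 := sqr_ge0 `|v|.
by rewrite ler_norml; apply/andP; split; lra.
Qed.

Lemma simple_fun_measurable_comp2 d (T : measurableType d) (a b : T -> H)
    (phi : H -> H -> R) : simple_fun a -> simple_fun b ->
  measurable_fun setT (fun x => phi (a x) (b x)).
Proof.
move=> [fa ma] [fb mb] _ A mA; rewrite setTI.
rewrite (_ : _ @^-1` _ = \bigcup_(p in range a `*` range b `&` [set p | A (phi p.1 p.2)])
    (a @^-1` [set p.1] `&` b @^-1` [set p.2])).
  apply: fin_bigcup_measurable => [|p _]; last exact: measurableI.
  by apply: finite_setIl; exact: finite_setX.
apply/seteqP; split => [x Ax|x [[y z] [_ /= Ayz] [/= -> ->]]//].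
by exists (a x, b x) => //; do 2 split => //=; exists x.
Qed.

(** Polarization writes the inner product through norms of [u + v] and [u - v], and these pass to
    the limit along simple approximations. *)
Lemma measurable_dot d (T : measurableType d) (D : set T) (u v : T -> H) :
  measurable D -> strongly_measurable D u -> strongly_measurable D v ->
  measurable_fun D (fun x => ip (u x) (v x)).
Proof.
move=> mD [a sa au] [b sb bv].
pose phi (y z : H) : R := (`|y + z| ^+ 2 - `|y - z| ^+ 2) / 4.
rewrite (_ : (fun x => _) = fun x => phi (u x) (v x)); last first.
  by apply/funext => x; exact: dot_polarization.
apply: (measurable_fun_cvg (h := fun n x => phi (a n x) (b n x))) => // [n|x Dx].
  by apply: measurable_funTS; exact: simple_fun_measurable_comp2.
apply: cvgM; last exact: cvg_cst.
have ax := au x Dx; have bx := bv x Dx.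
apply: cvgB; rewrite /= expr2; under eq_fun do rewrite expr2.
  by apply: cvgM; apply: cvg_norm; apply: cvgD.
by apply: cvgM; apply: cvg_norm; apply: cvgB.
Qed.

Local Notation lambda := (@lebesgue_measure R).

Lemma L2fun_dot_integrable (I : set R) (u v : R -> H) : measurable I ->
  L2fun I u -> L2fun I v -> lambda.-integrable I (fun s => (ip (u s) (v s))%:E).
Proof.
move=> mI [su Iu] [sv Iv].
have mn (w : R -> H) : strongly_measurable I w -> measurable_fun I (fun s => (`|w s| ^+ 2)%:E).
  move=> sw; apply/measurable_EFinP.
  rewrite (_ : (fun s => _) = fun s => ip (w s) (w s)).
    exact: measurable_dot.
  by apply/funext => s; rewrite ip_norm.
apply/integrableP; split; first by apply/measurable_EFinP; exact: measurable_dot.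
apply: (@le_lt_trans _ _ (\int[lambda]_(s in I) (`|u s| ^+ 2 + `|v s| ^+ 2)%:E)%E).
  apply: ge0_le_integral => //=.
  - apply/measurable_EFinP/measurableT_comp => //; exact: measurable_dot.
  - by under eq_fun do rewrite EFinD; apply: emeasurable_funD; exact: mn.
  - by move=> s _; rewrite lee_fin dot_norm_le.
under eq_integral do rewrite EFinD.
rewrite ge0_integralD//.
- by rewrite lte_add_pinfty.
- exact: mn.
- exact: mn.
Qed.

Lemma L2ipBl (I : set R) (u v g : R -> H) : measurable I ->
  L2fun I u -> L2fun I v -> L2fun I g ->
  L2ip ip I (u - v) g = L2ip ip I u g - L2ip ip I v g.
Proof.
move=> mI Lu Lv Lg; rewrite /L2ip -RintegralB//.
- by apply: eq_Rintegral => s _; rewrite !fctE linearDl linearNl.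
- exact: L2fun_dot_integrable.
- exact: L2fun_dot_integrable.
Qed.

Lemma L2ip_sym (I : set R) (u v : R -> H) : L2ip ip I u v = L2ip ip I v u.
Proof. by apply: eq_Rintegral => s _; exact: dot_sym. Qed.

Lemma L2ip_extend0 (I J : set R) (u v : R -> H) : I `<=` J ->
  L2ip ip J (extend0 I u) (extend0 I v) = L2ip ip I u v.
Proof.
move=> IJ; rewrite /L2ip Rintegral_mkcond [RHS]Rintegral_mkcond.
apply: eq_Rintegral => s _; rewrite !patchE /extend0 indicE.
have [sI|sI] := boolP (s \in I).
  by rewrite (mem_set (IJ _ (set_mem sI))) !scale1r.
by rewrite !scale0r linear0l; case: ifP.
Qed.

Lemma L2fun_extend0 (I J : set R) (u : R -> H) : measurable I -> I `<=` J ->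
  L2fun I u -> L2fun J (extend0 I u).
Proof.
move=> mI IJ [[a sa au] Iu]; split.
  exists (fun n => extend0 I (a n)).
    move=> n; have [fa ma] := sa n; split.
      apply: (@sub_finite_set _ _ ([set 0] `|` range (a n))).
        move=> _ [s _ <-]; rewrite /extend0 indicE.
        case: (s \in I); last by left; rewrite scale0r.
        by right; rewrite scale1r; exists s.
      by rewrite finite_setU; split.
    move=> y; rewrite (_ : _ @^-1` _ = (I `&` a n @^-1` [set y]) `|`
        (~` I `&` [set _ | 0 = y])).
      apply: measurableU; first exact: measurableI.
      apply: measurableI; first exact: measurableC.
      have [y0|y0] := pselect (0 = y).
        by rewrite (_ : [set _ | _] = setT)//; apply/seteqP; split.
      by rewrite (_ : [set _ | _] = set0)//; apply/seteqP; split.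
    apply/seteqP; split => s; rewrite /extend0 /= indicE.
      have [/set_mem sI|/negP sI] := boolP (s \in I).
        by rewrite scale1r => <-; left.
      rewrite scale0r => <-; right; split => // Is; apply: sI; exact: mem_set.
    move=> [[Is <-]|[nIs <-]].
      by rewrite mem_set// scale1r.
    by rewrite memNset// scale0r.
  move=> s Js; rewrite /extend0 indicE.
  have [/set_mem sI|sI] := boolP (s \in I).
    rewrite scale1r; under eq_fun do rewrite scale1r; exact: au.
  by rewrite scale0r; under eq_fun do rewrite scale0r; exact: cvg_cst.
suff -> : (\int[lambda]_(s in J) (`|extend0 I u s| ^+ 2)%:E =
    \int[lambda]_(s in I) (`|u s| ^+ 2)%:E)%E by [].
rewrite integral_mkcond [RHS]integral_mkcond.
apply: eq_integral => s _; rewrite !patchE /extend0 indicE.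
have [sI|sI] := boolP (s \in I).
  by rewrite (mem_set (IJ _ (set_mem sI))) scale1r.
by case: ifP => // _; rewrite scale0r normr0 expr0n.
Qed.

End inner_product_measurability.

(** Needed because [l (W_A(t))] equals [W (R_t^* l)] only almost surely. Measurability of [X] is a
    separate assumption since null sets of [P] need not have measurable subsets. *)
Lemma centred_gaussian_ae (R : realType) d (Om : measurableType d)
    (P : probability Om R) (X Z : Om -> R) : measurable_fun setT X ->
  {ae P, forall w, X w = Z w} -> centred_gaussian P Z -> centred_gaussian P X.
Proof.
move=> mX XZ [mZ [s ZE]]; split => //; exists s => A mA; rewrite -ZE//.
have mXA : measurable (X @^-1` A) by rewrite -[X in measurable X]setTI; exact: mX.
have mZA : measurable (Z @^-1` A) by rewrite -[X in measurable X]setTI; exact: mZ.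
rewrite /pushforward -(setIT (X @^-1` A)) -(setIT (Z @^-1` A)).
rewrite -!integral_indic//; apply: ae_eq_integral => //.
- exact/measurable_EFinP/measurable_indic.
- exact/measurable_EFinP/measurable_indic.
- apply: filterS XZ => w XZw _; rewrite !indicE; congr ((nat_of_bool _)%:R%:E).
  by apply/idP/idP => /set_mem Aw; apply/mem_set; move: Aw; rewrite /preimage/= XZw.
Qed.

(** * Isonormal processes *)

Section isonormal.
Context (R : realType) d (Om : measurableType d) (P : probability Om R).
Context (V : lmodType R) (L : set V) (b : V -> V -> R) (W : V -> Om -> R).
Hypothesis isoW : isonormal_process P L b W.

(** Three vectors, because [R_t^* l] has to be jointly Gaussian with both [h] and [Pi_t h]. *)
Lemma isonormal_gaussian3 (p q r : V) (x y z : R) : L p -> L q -> L r ->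
  centred_gaussian P (fun w => x * W p w + y * W q w + z * W r w).
Proof.
move=> Lp Lq Lr; have [_ gW _] := isoW.
have := @gW 3 (fun i => nth 0 [:: p; q; r] i) _ (fun i => nth 0 [:: x; y; z] i).
have H (i : 'I_3) : L (nth 0 [:: p; q; r] i) by case: i => -[|[|[|]]].
move=> /(_ H); congr (centred_gaussian P); apply/funext => w.
by rewrite !big_ord_recl big_ord0 /= addr0 addrA.
Qed.

Lemma isonormal_covariance (p q : V) : L p -> L q ->
  \int[P]_w (W p w * W q w) = b p q.
Proof.
move=> Lp Lq; have [_ _ cW] := isoW.
by have := cW _ _ Lp Lq; rewrite unlock /Rintegral => ->.
Qed.

End isonormal.

Lemma bounded_borel_translate (R : realType) (E : normedModType R) (a : E)
    (f : E -> R) : bounded_borel f -> bounded_borel (fun y => f (a + y)).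
Proof.
move=> [mf [M fM]]; split; last by exists M.
pose T := g_sigma_algebraType (@open E).
have mT : measurable_fun [set: T] ((fun y : E => a + y) : T -> T).
  apply: (@measurability _ _ T T setT _ (@open E)) => //.
  move=> _ [C oC <-]; rewrite setTI; apply: sub_sigma_algebra.
  apply: open_comp => // y _; apply: cvgD; [exact: cvg_cst|exact: cvg_id].
exact: (measurableT_comp mf mT).
Qed.

(** With zero weights the cosine condition is trivial, and of [transfer] only its measurability
    component is kept. *)
Lemma bounded_borel_comp (R : realType) (E : normedModType R) d
    (Om : measurableType d) (P : probability Om R) (V : Om -> E) (f : E -> R) :
  strongly_measurable setT V -> bounded_borel f -> measurable_fun setT (f \o V).
Proof.
move=> sV bf; have i0 : P.-integrable setT (EFin \o (fun=> 0 : R)).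
  exact: finite_measure_integrable_cst.
by have [] := transfer_cos_borel sV sV i0 i0 (fun l a cl => erefl) bf.
Qed.

(** * The derivative formula *)

Theorem theorem5p2 (R : realType)
  (E : completeNormedModType R)
  (H : completeNormedModType R) (ip : {dot H for idfun})
  (ip_norm : induces_norm ip) (H_separable : separable H)
  (S : R -> {linear E -> E}) (S_semigroup : C0_semigroup S)
  (B : {linear H -> E}) (B_bounded : continuous B)
  (d : measure_display) (Omega : measurableType d) (P : probability Omega R)
  (WH : R -> H -> Omega -> R) (WH_cbm : cylindrical_brownian_motion P ip WH)
  (SB_integrable : forall T : R, 0 < T ->
     stochastically_integrable_on ip T (fun s => S s \o B))
  (W : (R -> H) -> Omega -> R) (W_ext : is_isonormal_extension ip P WH W)
  (t : R) (t_gt0 : 0 < t)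
  (WA : Omega -> E)
  (WA_conv : is_gaussian_rv P (L2fun `]0, t[) (L2ip ip `]0, t[)
               (isonormal_restr W t) (R_op S B t) WA)
  (Pi : (R -> H) -> (R -> H))
  (Pi_proj : is_orth_projection (L2fun `]0, t[) (L2ip ip `]0, t[)
     (orth_complement (L2fun `]0, t[) (L2ip ip `]0, t[)
        (op_kernel (L2fun `]0, t[) (R_op S B t))) Pi)
  (xi : E) (h : R -> H) (h_L2 : L2fun `]0, t[ h)
  (xi_h : S t xi = R_op S B t h)
  (f : E -> R) (f_borel : bounded_borel f) (x : E) :
  let U := mild_solution S WA t x in
  let Ptf := transition_op P S WA t f in
  [/\ derivable Ptf x xi,
      ('D_xi Ptf x)%:E =
        'E_P[(fun w => f (U w) * isonormal_restr W t h w)%R]%E &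
      ('D_xi Ptf x)%:E =
        'E_P[(fun w => f (U w) * isonormal_restr W t (Pi h) w)%R]%E].
Proof.
move=> U Ptf.
have [sWA _ WA_adj] := WA_conv; have [isoW _] := W_ext.
pose I := (`]0, t[%classic : set R); pose J := (`[0, +oo[%classic : set R).
have mI : measurable I by exact: measurable_itv.
have IJ : I `<=` J by move=> s; rewrite /I /J /= !in_itv/= andbT => /andP[/ltW].
have ext (u : R -> H) : L2fun I u -> L2fun J (extend0 I u).
  exact: L2fun_extend0.
have Wcov u v : L2fun I u -> L2fun I v ->
    \int[P]_w (isonormal_restr W t u w * isonormal_restr W t v w) = L2ip ip I u v.
  move=> Lu Lv; rewrite /isonormal_restr.
  rewrite (isonormal_covariance isoW (ext _ Lu) (ext _ Lv)).
  exact: L2ip_extend0.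
have [Pih hPi] := Pi_proj h h_L2; have [LPi _] := Pih.
have gW3 p q r (a b c : R) : L2fun I p -> L2fun I q -> L2fun I r ->
    centred_gaussian P (fun w => a * isonormal_restr W t p w +
      b * isonormal_restr W t q w + c * isonormal_restr W t r w).
  by move=> Lp Lq Lr; apply: (isonormal_gaussian3 isoW); exact: ext.
have gW2 p q : L2fun I p -> L2fun I q -> forall a b : R,
    centred_gaussian P (fun w => a * isonormal_restr W t p w +
      b * isonormal_restr W t q w).
  move=> Lp Lq a b; have := gW3 p q q a b 0 Lp Lq Lq.
  by congr (centred_gaussian P); apply/funext => w; rewrite mul0r addr0.
have gW p : L2fun I p -> centred_gaussian P (isonormal_restr W t p).
  move=> Lp; have := gW2 p p Lp Lp 1 0.
  by congr (centred_gaussian P); apply/funext => w; rewrite mul1r mul0r addr0.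
have mW p : L2fun I p -> measurable_fun setT (isonormal_restr W t p).
  by move=> /gW [].
have iWM p q : L2fun I p -> L2fun I q -> P.-integrable setT
    (EFin \o (fun w => isonormal_restr W t p w * isonormal_restr W t q w)).
  by move=> Lp Lq; exact: (gaussian_pair_mul_integrable (gW2 p q Lp Lq)).
(* [k = 0] gives [W_t(h)] and [k = 1] stands for [W_t(h - Pi_t h)]. A difference of variables is
   used because [W] is linear only almost surely. *)
pose Y (k : R) w := isonormal_restr W t h w - k * isonormal_restr W t (Pi h) w.
have mY k : measurable_fun setT (Y k).
  by apply: measurable_funB; [exact: mW|apply: measurable_funM => //; exact: mW].
pose fx y := f (S t x + y).
have bfx : bounded_borel fx := bounded_borel_translate (S t x) f_borel.
(* For [g = R_t^* l] the left side of the condition is the covariance of [l (WA)] and [Y k], so the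
   condition says that [m] is the translation belonging to [Y k]. *)
have core (k : R) (m : E) :
    (forall (l : {linear E -> R^o}) g, continuous l ->
      is_adjoint_at (L2fun I) (L2ip ip I) (R_op S B t) l g ->
      L2ip ip I g h - k * L2ip ip I g (Pi h) = l m) ->
    is_derive (0 : R) (1 : R) (fun e => \int[P]_w fx (WA w + e *: m) : R)
      (\int[P]_w (fx (WA w) * Y k w)).
  move=> hm; apply: is_derive_cameron_martin => //.
  - move=> l cl u v; have [g [Lg _] lWA] := WA_adj l cl.
    have mlWA : measurable_fun setT (fun w => l (WA w) : R).
      exact: (strongly_measurable_comp (phi := l) cl sWA).
    apply: centred_gaussian_ae (gW3 g h (Pi h) u v (- (v * k)) Lg h_L2 LPi).
      by apply: measurable_funD; exact: measurable_funM.
    by apply: filterS lWA => w ->; rewrite /Y; ring.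
  - move=> l cl; have [g gadj lWA] := WA_adj l cl; have [Lg _] := gadj.
    have mlWA : measurable_fun setT (fun w => l (WA w) : R).
      exact: (strongly_measurable_comp (phi := l) cl sWA).
    rewrite -(hm l g cl gadj) -!Wcov// -RintegralZl//; last exact: iWM.
    rewrite -RintegralB//; last 2 first.
    + exact: iWM.
    + exact: (integrableZl measurableT k (iWM g (Pi h) Lg LPi)).
    rewrite /Rintegral; congr fine; apply: ae_eq_integral => //.
    + by apply/measurable_EFinP; exact: measurable_funM.
    + apply/measurable_EFinP; apply: measurable_funB.
        by apply: measurable_funM; exact: mW.
      apply: measurable_funM => //.
      by apply: measurable_funM; exact: mW.
    + by apply: filterS lWA => w + _ => ->; congr EFin; rewrite /Y; ring.
have mfx : measurable_fun setT (fx \o WA).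
  exact: (bounded_borel_comp P sWA bfx).
have [_ [M fxM]] := bfx.
have ifW p : L2fun I p -> P.-integrable setT
    (EFin \o (fun w => fx (WA w) * isonormal_restr W t p w)).
  move=> Lp; have := centred_gaussian_integrable (gW p Lp).
  exact: (integrable_boundedM mfx (fun w => fxM (WA w))).
have EfW p : L2fun I p -> 'E_P[(fun w => f (U w) * isonormal_restr W t p w)%R]%E =
    (\int[P]_w (fx (WA w) * isonormal_restr W t p w))%:E.
  move=> Lp; rewrite unlock /Rintegral fineK//.
  exact: (integrable_fin_num measurableT (ifW p Lp)).
have D1 : is_derive (0 : R) (1 : R) (fun e => \int[P]_w fx (WA w + e *: S t xi) : R)
    (\int[P]_w (fx (WA w) * isonormal_restr W t h w)).
  have := core 0 (S t xi); under eq_Rintegral do rewrite /Y mul0r subr0.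
  (* Adjointness: [(R_t^* l | h) = l (R_t h) = l (S(t) xi)]. *)
  apply=> l g cl [_ gadj]; rewrite mul0r subr0 gadj// xi_h//.
have D2 : \int[P]_w (fx (WA w) * Y 1 w) = 0.
  have c2 : is_derive (0 : R) (1 : R) (fun e => \int[P]_w fx (WA w + e *: 0) : R)
      (\int[P]_w (fx (WA w) * Y 1 w)).
    apply: core => l g cl [Lg gadj].
    rewrite linear0 mul1r (L2ip_sym ip I g h) (L2ip_sym ip I g (Pi h)).
    (* The vector [g = R_t^* l] lies in the orthogonal complement of the kernel, as its product with
       a kernel element [v] is [l (R_t v) = 0]; and [h - Pi h] is orthogonal to that complement. *)
    rewrite -(L2ipBl ip_norm mI h_L2 LPi Lg); apply: hPi.
    split => // v [Lv Rv]; rewrite gadj// Rv linear0//.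
  rewrite -(@derive_val _ _ _ _ _ _ _ c2); under eq_fun do rewrite scaler0.
  exact: derive_cst.
pose G (e : R) : R^o := \int[P]_w fx (WA w + e *: S t xi).
have PtfE e : Ptf (e *: xi + x) = G e.
  rewrite /Ptf /transition_op unlock /G /Rintegral; congr fine.
  apply: eq_integral => w _; rewrite /mild_solution /fx linearP /=.
  by congr (f _)%:E; rewrite [RHS]addrA [RHS]addrC [RHS]addrA.
(* By linearity of [S t], moving [x] by [e *: xi] translates the solution by [e *: S t xi]. The
   difference quotients of [Ptf] along [xi] are thus those of the real function [G] at 0. *)
have quotE : (fun e : R => e^-1 *: ((Ptf \o shift x) (e *: xi) - Ptf x)) =
    (fun e : R => e^-1 *: ((G \o shift 0) (e *: (1 : R^o)) - G 0)).
  apply/funext => e /=; rewrite PtfE addr0; congr (_ *: (G _ - _)).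
    by rewrite /GRing.scale/= mulr1.
  by rewrite -PtfE scale0r add0r.
have [G1 G2] := D1.
have DP : 'D_xi Ptf x = \int[P]_w (fx (WA w) * isonormal_restr W t h w).
  by rewrite -G2 /derive quotE.
split.
- by rewrite /derivable quotE; exact: G1.
- by rewrite EfW// DP.
- rewrite EfW// DP; congr EFin; apply/eqP; rewrite -subr_eq0 -RintegralB//.
  + rewrite -[X in _ == X]D2; apply/eqP; apply: eq_Rintegral => w _.
    by rewrite /Y mul1r mulrBr.
  + exact: ifW.
  + exact: ifW.
Qed.
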